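(* Let $x$ be an indeterminate, $\mathbb K=\mathbb Q(x)$, $k\ge2$ and $0\le r\le k$. For $p\in\mathcal P_k$ let $p'$ denote $p$ with its last entry deleted. Then $\tilde{\mathcal P}_k^r=\mathcal P_k^{r,1}\sqcup\mathcal P_k^{r,0}\sqcup\{[p]:p\in\mathcal P_k^{r,-1}\}$ is a basis of $\mathsf C_k^{(r)}$, and with respect to it the Gram matrix of $\langle\cdot,\cdot\rangle$ is block diagonal: $$\begin{pmatrix}\mathsf G_{k-1}^{(r-1)}&0&0\\0&\mathsf G_{k-1}^{(r)}&0\\0&0&\frac{u_{r+1}(x-1)}{u_r(x-1)}\mathsf G_{k-1}^{(r+1)}\end{pmatrix},$$ where the three blocks are indexed via the bijections $\mathcal P_k^{r,1}\to\mathcal P_{k-1}^{r-1}$, $p\mapsto p'$; $\mathcal P_k^{r,0}\to\mathcal P_{k-1}^{r}$, $p\mapsto p'$; and $\mathcal P_k^{r,-1}\to\mathcal P_{k-1}^{r+1}$, $p\mapsto(p_+)'$; i.e. $\langle p,q\rangle=\langle p',q'\rangle$ for $p,q$ both in $\mathcal P_k^{r,1}$ or both in $\mathcal P_k^{r,0}$, $\langle[p],[q]\rangle=\frac{u_{r+1}(x-1)}{u_r(x-1)}\langle(p_+)',(q_+)'\rangle$ for $p,q\in\mathcal P_k^{r,-1}$, and all pairings between different blocks vanish. Blocks $\mathsf G_j^{(i)}$ with $i<0$ or $i>j$ are empty.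
   Context: Motzkin algebra: a Motzkin $k$-diagram has top vertices $1..k$, bottom vertices $1'..k'$, edges each joining two distinct vertices, each vertex on at most one edge, edges planar. $\mathsf M_k(x)$: free $\mathbb K$-module on such diagrams with product: stack $d_1$ above $d_2$, let $d_3$ join outer vertices connected by a path, $d_1d_2=x^\kappa d_3$, $\kappa$ the number of closed middle loops. Rank = number of vertical edges; $\mathsf J_{r-1}$ = span of diagrams of rank $\le r-1$. Motzkin paths: $p=(a_1,\dots,a_k)$, $a_i\in\{-1,0,1\}$, partial sums $\ge0$, rank $\sum a_i$; $\mathcal P_k^r$ those of rank $r$; $\mathcal P_k^{r,\ell}$ those with $a_k=\ell$. Index $i$ with $a_i=1$ is paired with the smallest $j>i$ with $a_i+\dots+a_j=0$ if it exists. The 1-factor of $p$: row of vertices $1..k$, paired indices joined by an edge, unpaired $a_i=1$ white, others black; paths and 1-factors are identified. For $p,q\in\mathcal P_k^r$, $d_p^q$ has bottom-row edges $i'$—$j'$ for edges $\{i,j\}$ of $p$, top-row edges $i$—$j$ for edges of $q$, and vertical edges joining the $s$-th white vertex of $q$ (top) to the $s$-th white vertex of $p$ (bottom); other vertices isolated. $\mathsf C_k^{(r)}$ is the free $\mathbb K$-module on $\mathcal P_k^r$, with bilinear form $d_p^pd_q^q\equiv\langle p,q\rangle d_q^p\pmod{\mathsf J_{r-1}}$; $\mathsf G_k^{(r)}=(\langle p,q\rangle)_{p,q\in\mathcal P_k^r}$ is its Gram matrix. Chebyshev: $u_0(y)=1$, $u_1(y)=y$, $u_m(y)=y\,u_{m-1}(y)-u_{m-2}(y)$.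 For $p\in\mathcal P_k^{r,-1}$ the pivot edge is the edge $\{i,k\}$ of $p$. In general a pivot edge is a designated edge $\{i,j\}$ not nested in any other edge; $s$ = number of white vertices left of $i$; $p_\bullet$ is $p$ with the pivot edge deleted; $p^{(1)}=0$ if $s=0$, otherwise, with $m<i$ the rightmost white vertex, $p^{(1)}$ is obtained by deleting the pivot edge, adding the edge $\{m,i\}$ (the pivot of $p^{(1)}$) and coloring $j$ white; recursively $[0]=0$, $[p]=p-p_\bullet-\frac{u_{s-1}(x-1)}{u_s(x-1)}[p^{(1)}]$. $p_+$ is $p$ with the pivot edge removed and both endpoints colored white. *)

(* Defs.v *)
From HB Require Import structures.
From mathcomp Require Import all_boot all_order all_algebra.
From mathcomp Require Import fraction.
Set Implicit Arguments. Unset Strict Implicit. Unset Printing Implicit Defensive.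
Import Order.TTheory GRing.Theory Num.Theory.
Local Open Scope ring_scope.

Notation K := {fraction {poly rat}}.
Definition xK : K := FracField.tofrac ('X : {poly rat}).

Fixpoint cheb (R : pzRingType) (y : R) (m : nat) : R :=
  match m with
  | 0 => 1
  | m'.+1 => match m' with
             | 0 => y
             | m''.+1 => y * cheb y m' - cheb y m''
             end
  end.
Definition uK (m : nat) : K := cheb (xK - 1) m.

Definition step_ok (a : int) : bool := (a == 1) || (a == 0) || (a == -1).
Definition psum (p : seq int) (n : nat) : int := \sum_(0 <= t < n) p`_t.
Definition is_motzkin (k : nat) (p : seq int) : bool :=
  [&& size p == k, all step_ok p & all (fun n => 0 <= psum p n) (iota 0 k.+1)].
Definition mrank (p : seq int) : int := \sum_(a <- p) a.
Fixpoint allseqs (n : nat) : seq (seq int) :=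
  if n is n'.+1 then [seq a :: s | a <- [:: 1; 0; -1 : int], s <- allseqs n']
  else [:: [::]].
(* P_k^r (r an integer; empty when r < 0 or r > k) *)
Definition motzkin (k : nat) (r : int) : seq (seq int) :=
  [seq p <- allseqs k | is_motzkin k p && (mrank p == r)].

Definition segsum (p : seq int) (i j : nat) : int := \sum_(i <= t < j.+1) p`_t.
Definition partner (p : seq int) (i : nat) : option nat :=
  if p`_i == 1 then
    ohead [seq j <- iota i.+1 (size p - i.+1)%N | segsum p i j == 0]
  else None.
Definition white (p : seq int) (i : nat) : bool := (p`_i == 1) && (partner p i == None).
Definition pedge (p : seq int) (a b : nat) : bool :=
  (partner p a == Some b) || (partner p b == Some a).
Definition wrank (p : seq int) (i : nat) : nat := count (white p) (iota 0 i).

(* vertices of a k-diagram: (true, a) = top vertex a, (false, a) = bottom vertex a';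
   a diagram is given by its (symmetric) edge relation *)
Definition vtx (k : nat) := (bool * 'I_k)%type.

Definition dpq (k : nat) (p q : seq int) : rel (vtx k) := fun u v =>
  match u, v with
  | (false, a), (false, b) => pedge p a b
  | (true, a), (true, b) => pedge q a b
  | (true, a), (false, b) => [&& white q a, white p b & wrank q a == wrank p b]
  | (false, a), (true, b) => [&& white q b, white p a & wrank q b == wrank p a]
  end.

Arguments dpq k p q : clear implicits.

(* stacking d1 above d2: levels 0 (top of d1), 1 (middle), 2 (bottom of d2) *)
Definition svtx (k : nat) := ('I_3 * 'I_k)%type.
Definition stack_e (k : nat) (d1 d2 : rel (vtx k)) : rel (svtx k) := fun u v =>
  ([&& (u.1 <= 1)%N, (v.1 <= 1)%N & d1 (val u.1 == 0%N, u.2) (val v.1 == 0%N, v.2)])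
  || ([&& (1 <= u.1)%N, (1 <= v.1)%N & d2 (val u.1 == 1%N, u.2) (val v.1 == 1%N, v.2)]).
Definition stack_es (k : nat) (d1 d2 : rel (vtx k)) : rel (svtx k) :=
  fun u v => stack_e d1 d2 u v || stack_e d1 d2 v u.
Definition outv (k : nat) (u : vtx k) : svtx k :=
  (@inord 2 (if u.1 then 0%N else 2%N), u.2).
Definition dprod_rel (k : nat) (d1 d2 : rel (vtx k)) : rel (vtx k) := fun u v =>
  (outv u != outv v) && connect (stack_es d1 d2) (outv u) (outv v).
Definition middle (k : nat) (w : svtx k) : bool := val w.1 == 1%N.
Definition loopv (k : nat) (d1 d2 : rel (vtx k)) (w : svtx k) : bool :=
  [&& middle w, [exists b : 'I_k, d1 (false, w.2) (false, b)]
              & [exists b : 'I_k, d2 (true, w.2) (true, b)]].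
(* kappa: number of closed loops lying in the middle row
   (connected components all of whose vertices are middle vertices of degree 2) *)
Definition nloops (k : nat) (d1 d2 : rel (vtx k)) : nat :=
  #|[set v : svtx k | [&& middle v, fingraph.root (stack_es d1 d2) v == v &
       [forall w, connect (stack_es d1 d2) v w ==> loopv d1 d2 w]]]|.
Definition diag_eq (k : nat) (d d' : rel (vtx k)) : bool :=
  [forall u, forall v, d u v == d' u v].

(* <p,q>: the coefficient of d_q^p in d_p^p d_q^q = x^kappa d3 modulo J_{r-1}. *)
Definition pairing (k : nat) (p q : seq int) : K :=
  let d1 := dpq k p p in let d2 := dpq k q q in
  if diag_eq (dprod_rel d1 d2) (dpq k q p) then xK ^+ nloops d1 d2 else 0.

(* elements are represented by their coefficient functions on paths *)
Definition pvec (p : seq int) : seq int -> K := fun q => (q == p)%:R.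
Definition gform (k : nat) (r : int) (v w : seq int -> K) : K :=
  \sum_(p <- motzkin k r) \sum_(q <- motzkin k r) v p * w q * pairing k p q.
Definition rowv (k : nat) (r : int) (v : seq int -> K) : 'rV[K]_(size (motzkin k r)) :=
  \row_(t < size (motzkin k r)) v (nth [::] (motzkin k r) t).

Arguments rowv k r v : clear implicits.

Definition pdot (p : seq int) (i j : nat) : seq int := set_nth 0 (set_nth 0 p i 0) j 0.
Definition pone (p : seq int) (i j : nat) : seq int := set_nth 0 (set_nth 0 p i (-1)) j 1.
Definition lastwhite (p : seq int) (i : nat) : nat := last 0%N [seq t <- iota 0 i | white p t].
(* fuel n = s, the number of white vertices left of i *)
Fixpoint brack_aux (n : nat) (p : seq int) (i j : nat) : seq int -> K :=
  match n with
  | 0 => fun q => pvec p q - pvec (pdot p i j) q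
  | n'.+1 => fun q => pvec p q - pvec (pdot p i j) q
       - (uK n' / uK n'.+1) * brack_aux n' (pone p i j) (lastwhite p i) i q
  end.
Definition brack (p : seq int) (i j : nat) : seq int -> K := brack_aux (wrank p i) p i j.
(* for p in P_k^{r,-1}: pivot edge {i,k} *)
Definition pivl (p : seq int) : nat :=
  find (fun t => partner p t == Some (size p).-1) (iota 0 (size p)).
Definition bracket (p : seq int) : seq int -> K := brack p (pivl p) (size p).-1.
Definition pplus (p : seq int) : seq int := set_nth 0 (set_nth 0 p (pivl p) 1) (size p).-1 1.
Definition pprime (p : seq int) : seq int := take (size p).-1 p.
Definition tb (p : seq int) : seq int -> K := if last 0 p == -1 then bracket p else pvec p.

(* Main.v *)
Require Import Defs.
From HB Require Import structures.
From mathcomp Require Import all_boot all_order all_algebra.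
From mathcomp Require Import fraction.
From mathcomp Require Import zify ring.
Import Order.TTheory GRing.Theory Num.Theory.
Local Open Scope ring_scope.
Set Implicit Arguments. Unset Strict Implicit. Unset Printing Implicit Defensive.

(** Let q end in -1 and let b = q_+, with white vertices w_0 < ... < w_{r+1}, the last
    one being the vertex k.  Write cup_t(b) for b with the edge {w_t, w_{t+1}} added, and
    dots_t(b) for b with these two vertices coloured black.  Then q = cup_r(b), every path
    occurring in [q] is a cup_t(b) or a dots_t(b), and [q] = B_r, where
      B_t = cup_t(b) - dots_t(b) - (u_{t-1} / u_t) B_{t-1}.
    For a path p of rank r, the strands of the superposition of p and b form a planar
    diagram from r points to r+2 points, closed by cup_t or dots_t.  Planarity leaves two
    kinds of diagrams with a nonzero contribution: if the points t, t+1 are dead ends and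
    the rest is the identity, then cup_t and dots_t cancel; if they are joined by an arc
    and the rest is the identity, then the contributions of t-1, t, t+1 are 1, x - 1, 1
    times a common power of x, and the Chebyshev recurrence collapses the sum.  Hence
    <p, [q]> vanishes unless the arc is at t = r, which forces p to end in -1, and in that
    case it is u_{r+1}/u_r times a pairing of paths with k - 1 steps.
    Planarity and the fact that each component is a cycle or has two ends are proved by
    adding the edges of both factors one at a time, always joining consecutive whites. *)

(** * Heights *)

(** The pairing is defined by stacking diagrams, but in [d_p^p d_q^q] the outer rows merely follow
    the middle one. Superposing the two 1-factors on a single row decides everything: the pairing is
    x to the number of cycles if each white vertex of p shares its strand with the white vertex of q
    of the same rank and with no other white of q, and 0 otherwise. All terms of a bracket are
    handled over one superposition, that of p and b: a cup adds one edge to it, and dots only change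
    which ends count. The value x - 1 is what remains of x^(n+1) - x^n when an arc is either closed
    into a cycle by the cup or left open by the dots; this is why the Chebyshev argument is x - 1.
    For two brackets, p is the only term of [p] ending in -1 and every other term is orthogonal to
    [q], so <[p],[q]> = <p,[q]>. The same triangularity gives the basis. Edges and white vertices
    are expressed by inequalities between partial sums (heights), which turns the combinatorics of
    1-factors into linear arithmetic. *)

Lemma psum0 p : psum p 0 = 0.
Proof. by rewrite /psum big_geq. Qed.

Lemma psumS p n : psum p n.+1 = psum p n + p`_n.
Proof. by rewrite /psum big_nat_recr. Qed.

Lemma segsumE p i j : (i <= j)%N -> segsum p i j = psum p j.+1 - psum p i.
Proof.
move=> ij; have -> : psum p j.+1 = psum p i + segsum p i j.
  by rewrite /psum /segsum -big_cat_nat //; lia.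
by rewrite addrAC subrr add0r.
Qed.

Lemma mrankE p : mrank p = psum p (size p).
Proof. by rewrite /mrank (big_nth 0). Qed.

Lemma psum_oversize p n : (size p <= n)%N -> psum p n = psum p (size p).
Proof.
move=> /subnK <-; elim: (n - size p)%N => // m IH.
by rewrite addSn psumS IH nth_default ?addr0 // leq_addl.
Qed.

Lemma step_okP a : reflect (-1 <= a <= 1) (step_ok a).
Proof. by apply: (iffP idP); rewrite /step_ok; lia. Qed.

(** Both bounds hold for every index: past the end the default entry 0 is a legal step and the
    heights are constant, so no range condition has to be carried along. *)
Record motzkin_path (k : nat) (p : seq int) : Prop := MotzkinPath {
  mp_size : size p = k;
  mp_step : forall n, -1 <= p`_n <= 1;
  mp_ge0 : forall n, 0 <= psum p n }.

Lemma is_motzkinP k p : reflect (motzkin_path k p) (is_motzkin k p).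
Proof.
apply: (iffP and3P) => [[/eqP sz /allP st /allP ps]|[sz st ps]].
  split=> // n.
    have [ns|ns] := ltnP n (size p); last by rewrite nth_default.
    by apply/step_okP/st/mem_nth.
  have [ns|ns] := leqP n (size p); last rewrite psum_oversize; last lia.
    by apply: ps; rewrite mem_iota; lia.
  by apply: ps; rewrite mem_iota; lia.
split; first by rewrite sz.
  by apply/allP => a /(nthP 0)[n _ <-]; apply/step_okP.
by apply/allP => n _; apply: ps.
Qed.

Lemma allseqsS n :
  allseqs n.+1 = [seq a :: s | a <- [:: 1; 0; -1], s <- allseqs n].
Proof. by []. Qed.

Lemma mem_allseqs n s : (s \in allseqs n) = (size s == n) && all step_ok s.
Proof.
elim: n s => [|n IH] s; first by case: s.
rewrite allseqsS; apply/allpairsP/idP => [[[b t] /= [b3]]|].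
  rewrite IH => /andP[/eqP tn tok] ->.
  by rewrite /= tn eqxx tok andbT /=; move: b3; rewrite !inE /step_ok orbA.
case: s => //= a s /andP[sn /andP[aok sok]]; exists (a, s); split=> //=.
  by rewrite !inE; move: aok; rewrite /step_ok orbA.
by rewrite IH -eqSS sn.
Qed.

Lemma allseqs_uniq n : uniq (allseqs n).
Proof.
elim: n => // n IH; rewrite allseqsS; apply: allpairs_uniq => //.
by move=> [a s] [b t] _ _ [-> ->].
Qed.

Lemma motzkin_uniq k r : uniq (motzkin k r).
Proof. by rewrite filter_uniq ?allseqs_uniq. Qed.

Lemma mem_motzkin k r p :
  (p \in motzkin k r) = is_motzkin k p && (mrank p == r).
Proof.
rewrite mem_filter mem_allseqs andbC.
case E: (is_motzkin k p); last by rewrite andbF.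
by case/and3P: E => -> ->.
Qed.

Lemma motzkinP k r p :
  reflect (motzkin_path k p /\ psum p k = r) (p \in motzkin k r).
Proof.
rewrite mem_motzkin; apply: (iffP andP) => [[/is_motzkinP mp /eqP]|[mp pr]].
  by rewrite mrankE (mp_size mp).
by split; [apply/is_motzkinP | rewrite mrankE (mp_size mp) pr].
Qed.

Lemma ohead_filter_iota_Some (P : pred nat) m n b :
  ohead [seq j <- iota m n | P j] = Some b <->
  [/\ (m <= b < m + n)%N, P b & forall j, (m <= j < b)%N -> ~~ P j].
Proof.
elim: n m => [|n IH] m /=; first by split=> // -[]; lia.
case Pm: (P m) => /=.
  split=> [[<-]|[mb Pb nP]]; first by split=> //; lia.
  have [//|bm] := eqVneq b m; first by move=> ->.
  by have /negP := nP m ltac:(lia); rewrite Pm.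
rewrite IH; split=> -[mb Pb nP]; split=> //.
- by lia.
- move=> j mj; have [->|jm] := eqVneq j m; first by rewrite Pm.
  by apply: nP; lia.
- have : b != m by apply: contraTneq Pb => ->; rewrite Pm.
  by lia.
- by move=> j mj; apply: nP; lia.
Qed.

Lemma ohead_filter_iota_None (P : pred nat) m n :
  ohead [seq j <- iota m n | P j] = None <->
  forall j, (m <= j < m + n)%N -> ~~ P j.
Proof.
split=> [|nP].
  case E: [seq j <- iota m n | P j] => [|//] _ j mj.
  apply/negP => Pj; suff : j \in [seq j <- iota m n | P j] by rewrite E.
  by rewrite mem_filter Pj mem_iota.
case E: [seq j <- iota m n | P j] => [//|j s].
have : j \in [seq j <- iota m n | P j] by rewrite E mem_head.
by rewrite mem_filter mem_iota => /andP[Pj /nP]; rewrite Pj.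
Qed.

Section Heights.
Variables (k : nat) (p : seq int).
Hypothesis mp : motzkin_path k p.

Lemma step_psum n : psum p n - 1 <= psum p n.+1 <= psum p n + 1.
Proof. by rewrite psumS; have := mp_step mp n; lia. Qed.

Lemma psum_stable n : (k <= n)%N -> psum p n = psum p k.
Proof. by move=> kn; rewrite psum_oversize (mp_size mp). Qed.

(** The pairing rule in terms of heights: the path rises at [a] and returns to its former height for
    the first time just after [b]. *)
Definition arch a b := [/\ (a < b)%N, psum p b.+1 = psum p a
  & forall n, (a < n <= b)%N -> psum p a < psum p n].

(* A lattice path cannot jump over the level [psum p a]. *)
Lemma psum_gt a b : psum p a < psum p a.+1 ->
  (forall j, (a < j < b)%N -> psum p j.+1 != psum p a) ->
  forall n, (a < n <= b)%N -> psum p a < psum p n.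
Proof.
move=> up ne; elim=> // n IH an.
have [na|na] := eqVneq n a; first by rewrite na.
have := IH ltac:(lia); have := ne n ltac:(lia); have := step_psum n; lia.
Qed.

Lemma partnerP a b : partner p a = Some b <-> arch a b.
Proof.
rewrite /partner; case: eqP => pa; last first.
  split=> // -[ab _ /(_ a.+1 ltac:(lia))]; rewrite psumS.
  by have := mp_step mp a; lia.
rewrite ohead_filter_iota_Some; have ua : psum p a.+1 = psum p a + 1 by rewrite psumS pa.
split=> [[ab /eqP sb ns]|[ab pb gt]].
  split; [lia| by move: sb; rewrite segsumE; lia |].
  apply: psum_gt => [|j aj]; first by lia.
  by have := ns j ltac:(lia); rewrite segsumE; lia.
have bk : (b < size p)%N.
  rewrite (mp_size mp) ltnNge; apply/negP => kb.
  by have := gt b ltac:(lia); rewrite -pb !psum_stable; lia.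
split; [lia|by apply/eqP; rewrite segsumE; lia|].
by move=> j aj; rewrite segsumE; [have := gt j.+1 ltac:(lia); lia|lia].
Qed.

Lemma whiteP a : white p a <->
  (a < k)%N /\ (forall n, (a < n <= k)%N -> psum p a < psum p n).
Proof.
rewrite /white /partner; have sz := mp_size mp; split.
  case: eqP => //= pa /eqP /ohead_filter_iota_None ns.
  have ak : (a < k)%N.
    by rewrite -sz ltnNge; apply/negP => /(nth_default 0); rewrite pa.
  split=> //; apply: psum_gt => [|j aj]; first by rewrite psumS pa; lia.
  by have := ns j ltac:(lia); rewrite segsumE; lia.
move=> [ak gt]; have := gt a.+1 ltac:(lia); rewrite psumS.
have := mp_step mp a => st up; have pa : p`_a = 1 by lia.
rewrite pa /=; apply/eqP/ohead_filter_iota_None => j aj.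
by rewrite segsumE; [have := gt j.+1 ltac:(lia); lia|lia].
Qed.

Lemma pedgeP a b : reflect (arch a b \/ arch b a) (pedge p a b).
Proof.
apply: (iffP orP) => [[] /eqP/partnerP|[] /partnerP ->]; [by left|by right|by left|by right].
Qed.

Lemma arch_lt a b : arch a b -> (b < k)%N.
Proof.
case=> ab pb gt; rewrite ltnNge; apply/negP => kb.
by have := gt b ltac:(lia); rewrite -pb !psum_stable; lia.
Qed.

(* The whites left of [n] are counted by the minimum of the path from [n] on. *)
Lemma wrank_min n : (n <= k)%N ->
  (forall m, (n <= m <= k)%N -> (wrank p n)%:Z <= psum p m) /\
  (exists2 m, (n <= m <= k)%N & psum p m = (wrank p n)%:Z).
Proof.
elim: n => [|n IH] nk.
  split=> [m _|]; first exact: (mp_ge0 mp).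
  by exists 0%N; rewrite // psum0.
have [lb [m nm em]] := IH ltac:(lia).
rewrite /wrank -addn1 iotaD count_cat /= add0n addn0 -/(wrank p n).
case wn: (white p n) => /=.
  have [_ gt] := (whiteP n).1 wn.
  have mn : m = n by apply/eqP; apply: contraT => mn; have := gt m ltac:(lia); have := lb n ltac:(lia); lia.
  have en : psum p n = (wrank p n)%:Z by rewrite -em mn.
  split=> [m' nm'|]; first by have := gt m' ltac:(lia); lia.
  by exists n.+1; [lia|have := gt n.+1 ltac:(lia); have := step_psum n; lia].
rewrite addn0; split=> [m' nm'|]; first by apply: lb; lia.
have [mn|mn] := eqVneq m n; last by exists m => //; lia.
(* If the minimum is attained at [n], which is not white, it is attained again later: otherwise the
   path would stay above the height of [n]. *)
subst m; case: (pickP (fun i : 'I_k.+1 => (n < i)%N && (psum p i == psum p n))) => [i /andP[ni /eqP ei]|no].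
  by exists (i : nat); [have := ltn_ord i; lia | rewrite ei em].
have /negP[] := negbT wn; apply/whiteP; split; first by lia.
move=> m nm'; have lbm := lb m ltac:(lia).
have := no (inord m); rewrite /= inordK; last lia.
have -> /= : (n < m)%N by case/andP: nm'.
by move=> /eqP; lia.
Qed.

Lemma wrank_white a : white p a -> (wrank p a)%:Z = psum p a.
Proof.
move=> /whiteP[ak gt]; have [lb [m am em]] := wrank_min (ltnW ak).
have := lb a ltac:(lia); have [ma|ma] := eqVneq m a; first by rewrite -em ma.
by have := gt m ltac:(lia); lia.
Qed.

Lemma wrank_size : (wrank p k)%:Z = psum p k.
Proof.
by have [_ [m am em]] := wrank_min (leqnn k); rewrite -em; congr psum; lia.
Qed.

End Heights.

(** * Joining or erasing two consecutive white vertices *)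

Lemma psum_set_nth p c v n :
  psum (set_nth 0 p c v) n = psum p n + (v - p`_c) * (c < n)%N%:Z.
Proof.
elim: n => [|n IH]; first by rewrite !psum0 mulr0.
rewrite !psumS IH nth_set_nth /=; case: eqP => [->|]; last by lia.
by rewrite ltnn ltnSn; lia.
Qed.

Lemma motzkin_path_set_nth k p c v : motzkin_path k p -> (c < k)%N ->
  -1 <= v <= 1 -> (forall n, 0 <= psum p n + (v - p`_c) * (c < n)%N%:Z) ->
  motzkin_path k (set_nth 0 p c v).
Proof.
move=> mp ck v1 ge0; split.
- by rewrite size_set_nth (mp_size mp); lia.
- by move=> n; rewrite nth_set_nth /=; case: eqP => // _; apply: mp_step mp n.
- by move=> n; rewrite psum_set_nth.
Qed.

Lemma arch_white k p a b : motzkin_path k p -> arch p a b -> ~~ white p a && ~~ white p b.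
Proof.
move=> mp ab; have bk := arch_lt mp ab; case: ab => ab pb gt.
by apply/andP; split; apply/negP => /(whiteP mp)[_]; [move/(_ b.+1)|move/(_ b.+1); have := gt b]; lia.
Qed.

Lemma arch_step k p a b : motzkin_path k p -> arch p a b -> p`_a = 1 /\ p`_b = -1.
Proof.
move=> mp [ab pb gt]; have := mp_step mp a; have := mp_step mp b.
have := gt b; have := gt a.+1; have := psumS p a; have := psumS p b; lia.
Qed.

Lemma white_step k p a : motzkin_path k p -> white p a -> p`_a = 1.
Proof.
by move=> mp /(whiteP mp)[ak /(_ a.+1)]; have := mp_step mp a; have := psumS p a; lia.
Qed.

Section Cup.
Variables (k : nat) (b : seq int) (a c : nat).
Hypotheses (mb : motzkin_path k b) (wa : white b a) (wc : white b c).
Hypothesis ac : wrank b c = (wrank b a).+1.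

Definition cup : seq int := set_nth 0 b c (-1).

Let hac : psum b c = psum b a + 1.
Proof. by rewrite -(wrank_white mb wa) -(wrank_white mb wc) ac; lia. Qed.

Let ha n : (a < n)%N -> psum b a < psum b n.
Proof.
move=> an; have /(whiteP mb)[ak gt] := wa; have [nk|nk] := leqP n k; first by apply: gt; lia.
by rewrite (@psum_stable _ _ mb n) ?gt; lia.
Qed.

Let hc n : (c < n)%N -> psum b c < psum b n.
Proof.
move=> cn; have /(whiteP mb)[ck gt] := wc; have [nk|nk] := leqP n k; first by apply: gt; lia.
by rewrite (@psum_stable _ _ mb n) ?gt; lia.
Qed.

Lemma cup_lt : (a < c < k)%N.
Proof.
have /(whiteP mb)[ck gt] := wc; rewrite ck andbT; case: ltngtP => // [ca|ca].
  by have := hc ca; lia.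
by move: hac; rewrite ca; lia.
Qed.

Let ba : b`_a = 1. Proof. exact: white_step mb wa. Qed.
Let bc : b`_c = 1. Proof. exact: white_step mb wc. Qed.

Lemma psum_cup n : psum cup n = psum b n - 2 * (c < n)%N%:Z.
Proof. by rewrite psum_set_nth bc; lia. Qed.

Lemma psum_dots n : psum (pdot b a c) n = psum b n - (a < n)%N%:Z - (c < n)%N%:Z.
Proof.
by rewrite !psum_set_nth nth_set_nth /= ba bc; have := cup_lt; case: eqP; lia.
Qed.

Lemma motzkin_path_cup : motzkin_path k cup.
Proof.
apply: motzkin_path_set_nth => //; first by have := cup_lt; lia.
move=> n; rewrite bc; have := mp_ge0 mb n; have := mp_ge0 mb a.
by have := @hc n; lia.
Qed.

Lemma motzkin_path_dots : motzkin_path k (pdot b a c).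
Proof.
have acl := cup_lt; have := psum_dots.
rewrite /pdot => pd; split.
- by rewrite !size_set_nth (mp_size mb); lia.
- by move=> n; rewrite !nth_set_nth /= nth_set_nth /=; case: eqP => // _; case: eqP => // _; apply: mp_step mb n.
- move=> n; rewrite pd; have := mp_ge0 mb n; have := mp_ge0 mb a.
  by have := @hc n; have := @ha n; lia.
Qed.

Let hcS : psum b c.+1 = psum b c + 1.
Proof. by rewrite psumS bc. Qed.

(** The new step at [c] lowers all later heights by 2. Consecutive whites differ in height by 1, so
    the path returns to the height of [a] just after [c]. An arch of [b] cannot reach across a white
    vertex, so it lies on one side of [c] and keeps its shape. *)
Lemma arch_cup x y : arch cup x y <-> arch b x y \/ (x = a /\ y = c).
Proof.
have acl := cup_lt; split.
  case=> xy; rewrite !psum_cup => e gt.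
  have gt' n : (x < n <= y)%N -> psum b x - 2 * (c < x)%N%:Z < psum b n - 2 * (c < n)%N%:Z.
    by move=> xn; have := gt n xn; rewrite ?psum_cup.
  have [yc|cy|yc] := ltngtP y c.
  - by left; split=> // [|n xn]; [lia | have := gt' n xn; lia].
  - left; have := gt' c.+1; have := @hc y.+1 ltac:(lia) => h1 h2.
    have cx : (c < x)%N by case: (ltngtP x c) => [||xc] //; try subst x; lia.
    by split=> // [|n xn]; [lia | have := gt' n xn; lia].
  - right; subst y; split=> //; case: (ltngtP x a) => // xa; last by have := ha xa; lia.
    by have := gt' a; lia.
case=> [[xy e gt]|[-> ->]]; last first.
  split; [lia | by rewrite !psum_cup; lia | move=> n an; rewrite !psum_cup].
  by have := @ha n; lia.
have [yc|cy|yc] := ltngtP y c; last 1 first.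
- by have := gt c; subst y; lia.
- by split=> // [|n xn]; rewrite !psum_cup; [lia | have := gt n xn; lia].
have cx : (c < x)%N.
  case: (ltngtP x c) => // xc; last by subst x; have := @hc y.+1; lia.
  by have := gt c; have := @hc y.+1; lia.
by split=> // [|n xn]; rewrite !psum_cup; [lia | have := gt n xn; lia].
Qed.

(** No arch reaches across [a] or [c], so each lies in one of three zones, before [a], between [a]
    and [c], or after [c]. On these the heights drop by the constants 0, 1 and 2. *)
Lemma arch_dots x y : arch (pdot b a c) x y <-> arch b x y.
Proof.
have acl := cup_lt; split.
  case=> xy; rewrite !psum_dots => e gt.
  have gt' n : (x < n <= y)%N -> psum b x - (a < x)%N%:Z - (c < x)%N%:Z
      < psum b n - (a < n)%N%:Z - (c < n)%N%:Z.
    by move=> xn; have := gt n xn; rewrite ?psum_dots.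
  have h1 := @ha y.+1; have h2 := @hc y.+1.
  have g1 := gt' a.+1; have g2 := gt' c.+1; have g3 := gt' a; have g4 := gt' c.
  have haS : psum b a.+1 = psum b a + 1 by rewrite psumS ba.
  have h3 := @ha x; have h4 := @hc x.
  have [||] : [\/ (y < a)%N, (a < x)%N && (y < c)%N | (c < x)%N].
    have [ya|ya] := ltnP y a; first by constructor 1.
    have [xa|xa] := ltnP a x; last by suff: false by []; have := eqVneq x a; case => ?; [subst x|]; lia.
    have [yc|yc] := ltnP y c; first by constructor 2.
    by constructor 3; case: (ltngtP x c) => // xc; [|subst x]; lia.
  - by move=> ya; split=> // [|n xn]; [lia | have := gt' n xn; lia].
  - by move=> ya; split=> // [|n xn]; [lia | have := gt' n xn; lia].
  - by move=> ya; split=> // [|n xn]; [lia | have := gt' n xn; lia].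
case=> xy e gt.
have h1 := @ha y.+1; have h2 := @hc y.+1.
have g3 := gt a; have g4 := gt c.
have [||] : [\/ (y < a)%N, (a < x)%N && (y < c)%N | (c < x)%N].
  have [ya|ya] := ltnP y a; first by constructor 1.
  have [xa|xa] := ltnP a x; last by suff: false by []; have := eqVneq x a; case => ?; [subst x|]; lia.
  have [yc|yc] := ltnP y c; first by constructor 2.
  by constructor 3; case: (ltngtP x c) => // xc; [|subst x]; lia.
- by move=> ya; split=> // [|n xn]; rewrite !psum_dots; [lia | have := gt n xn; lia].
- by move=> ya; split=> // [|n xn]; rewrite !psum_dots; [lia | have := gt n xn; lia].
- by move=> ya; split=> // [|n xn]; rewrite !psum_dots; [lia | have := gt n xn; lia].
Qed.

Lemma pedge_cup x y : pedge cup x y =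
  pedge b x y || ((x == a) && (y == c)) || ((x == c) && (y == a)).
Proof.
apply/(pedgeP motzkin_path_cup)/orP => [[/arch_cup[]|/arch_cup[]]|[/orP[]|]].
- by left; apply/orP; left; apply/(pedgeP mb); left.
- by case=> -> ->; left; rewrite !eqxx orbT.
- by left; apply/orP; left; apply/(pedgeP mb); right.
- by case=> -> ->; right; rewrite !eqxx.
- by case/(pedgeP mb); [left|right]; apply/arch_cup; left.
- by case/andP => /eqP -> /eqP ->; left; apply/arch_cup; right.
- by case/andP => /eqP -> /eqP ->; right; apply/arch_cup; right.
Qed.

Lemma pedge_dots x y : pedge (pdot b a c) x y = pedge b x y.
Proof.
by apply/(pedgeP motzkin_path_dots)/(pedgeP mb) => -[] /arch_dots; [left|right|left|right].
Qed.

Lemma white_cup x : white cup x = [&& white b x, x != a & x != c].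
Proof.
have acl := cup_lt; apply/idP/and3P.
  move=> /(whiteP motzkin_path_cup)[xk gt]; have gt' n : (x < n <= k)%N -> psum b x - 2 * (c < x)%N%:Z < psum b n - 2 * (c < n)%N%:Z.
    by move=> xn; have := gt n xn; rewrite ?psum_cup.
  split.
  - apply/(whiteP mb); split=> // n xn; have := gt' n xn.
    by case: (ltngtP x c) => // xc; lia.
  - by apply/eqP => xa; have := gt' c.+1; subst x; lia.
  - by apply/eqP => xa; have := gt' c.+1; subst x; lia.
case=> /(whiteP mb)[xk gt] xa xc; apply/(whiteP motzkin_path_cup); split=> // n xn; rewrite !psum_cup.
have := gt n xn; have := gt a; have := gt c.
have := @hc n; have := @ha n; have := @hc x; have := @ha x.
by move: xa xc; lia.
Qed.

Lemma white_dots x : white (pdot b a c) x = [&& white b x, x != a & x != c].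
Proof.
have acl := cup_lt; apply/idP/and3P.
  move=> /(whiteP motzkin_path_dots)[xk gt]; have gt' n : (x < n <= k)%N -> psum b x - (a < x)%N%:Z - (c < x)%N%:Z < psum b n - (a < n)%N%:Z - (c < n)%N%:Z.
    by move=> xn; have := gt n xn; rewrite ?psum_dots.
  have haS : psum b a.+1 = psum b a + 1 by rewrite psumS ba.
  split.
  - apply/(whiteP mb); split=> // n xn; have := gt' n xn; lia.
  - by apply/eqP => xa; have := gt' a.+1; subst x; lia.
  - by apply/eqP => xa; have := gt' c.+1; subst x; lia.
case=> /(whiteP mb)[xk gt] xa xc; apply/(whiteP motzkin_path_dots); split=> // n xn; rewrite !psum_dots.
have := gt n xn; have := gt a; have := gt c.
have := @hc n; have := @ha n; have := @hc x; have := @ha x.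
by move: xa xc; lia.
Qed.

Lemma white_between x : white b x -> (a < x < c)%N -> False.
Proof.
move=> /(whiteP mb)[xk gt] xac; have := gt c; have := @ha x; have := cup_lt; lia.
Qed.

End Cup.

(* Every -1 with no -1 after it closes an outermost edge, so turning it into 1
   undoes a [cup]. *)
Lemma uncup k p c : motzkin_path k p -> (c < k)%N -> p`_c = -1 ->
  (forall n, (c < n)%N -> p`_n != -1) ->
  exists a, [/\ motzkin_path k (set_nth 0 p c 1), white (set_nth 0 p c 1) a,
    white (set_nth 0 p c 1) c,
    wrank (set_nth 0 p c 1) c = (wrank (set_nth 0 p c 1) a).+1 &
    cup (set_nth 0 p c 1) c = p /\ arch p a c].
Proof.
move=> mp ck pc after.
have pb n : psum (set_nth 0 p c 1) n = psum p n + 2 * (c < n)%N%:Z.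
  by rewrite psum_set_nth pc; lia.
have mb : motzkin_path k (set_nth 0 p c 1).
  by apply: motzkin_path_set_nth => // n; rewrite pc; have := mp_ge0 mp n; lia.
have up n : (c < n)%N -> psum p c.+1 <= psum p n.
  elim: n => // n IH cn; have [->//|nc] := eqVneq n c.
  rewrite [leRHS]psumS; have := IH ltac:(lia); have := mp_step mp n; have := after n ltac:(lia); lia.
have pcS : psum p c.+1 = psum p c - 1 by rewrite psumS pc.
(* The opening vertex is the last position up to [c] whose height does not exceed the height just
   after [c]; position 0, of height 0, qualifies. *)
pose Q := [pred n | (n <= c)%N && (psum p n <= psum p c.+1)].
have Q0 : exists n, Q n by exists 0%N; rewrite /= psum0; have := mp_ge0 mp c.+1.
have Qc n : Q n -> (n <= c)%N by case/andP.
case: (ex_maxnP Q0 Qc) => a /andP[ac pa] amax.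
have gt n : (a < n <= c)%N -> psum p c.+1 < psum p n.
  move=> an; rewrite ltNge; apply/negP => le; have := amax n; rewrite /= le andbT; lia.
have {ac} ac : (a < c)%N by have := eqVneq a c; case=> ?; [subst a|]; lia.
have ea : psum p a = psum p c.+1.
  by have := gt a.+1 ltac:(lia); have := step_psum mp a; lia.
have wa : white (set_nth 0 p c 1) a.
  apply/(whiteP mb); split=> [|n an]; first by lia.
  by rewrite !pb; have := gt n; have := up n; lia.
have wc : white (set_nth 0 p c 1) c.
  by apply/(whiteP mb); split=> // n cn; rewrite !pb; have := up n; lia.
exists a; split=> //.
- by have := wrank_white mb wa; have := wrank_white mb wc; rewrite !pb; lia.
split; last by split=> // n an; rewrite ea; apply: gt.
apply: (@eq_from_nth _ 0) => [|n _].
    by rewrite !size_set_nth (mp_size mp); lia.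
  by rewrite !nth_set_nth /= nth_set_nth /=; case: eqP => // ->.
Qed.

(** * White vertices indexed by rank *)

Definition wpos (p : seq int) (s : nat) : nat :=
  nth 0%N [seq x <- iota 0 (size p) | white p x] s.

Lemma nth_filter_iota (P : pred nat) n x : P x -> (x < n)%N ->
  nth 0%N [seq i <- iota 0 n | P i] (count P (iota 0 x)) = x.
Proof.
move=> Px xn; have -> : iota 0 n = iota 0 x ++ x :: iota x.+1 (n - x.+1).
  have -> : n = (x + (n - x.+1).+1)%N by lia.
  by rewrite iotaD /= add0n; do 3!f_equal; lia.
by rewrite filter_cat /= Px nth_cat size_filter ltnn subnn.
Qed.

Lemma wrankS p x : wrank p x.+1 = (wrank p x + white p x)%N.
Proof. by rewrite /wrank -addn1 iotaD count_cat /= add0n addn0. Qed.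

Lemma leq_wrank p x y : (x <= y)%N -> (wrank p x <= wrank p y)%N.
Proof. by move=> /subnK <-; elim: (y - x)%N => // n IH; rewrite addSn wrankS; lia. Qed.

Lemma ltn_wrank p x y : white p x -> (x < y)%N -> (wrank p x < wrank p y)%N.
Proof. by move=> wx /(leq_wrank p); rewrite wrankS wx; lia. Qed.

Lemma wrank_inj p x y : white p x -> white p y -> wrank p x = wrank p y -> x = y.
Proof.
by move=> wx wy e; case: (ltngtP x y) => // h; [have := ltn_wrank wx h|have := ltn_wrank wy h]; lia.
Qed.

Section Wpos.
Variables (k : nat) (p : seq int).
Hypothesis mp : motzkin_path k p.

Lemma white_lt x : white p x -> (x < k)%N.
Proof. by case/(whiteP mp). Qed.

Lemma wrank_ltn x : white p x -> (wrank p x < wrank p k)%N.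
Proof. by move=> wx; apply: ltn_wrank => //; apply: white_lt. Qed.

Lemma wposK x : white p x -> wpos p (wrank p x) = x.
Proof. by move=> wx; apply: nth_filter_iota => //; rewrite (mp_size mp) white_lt. Qed.

Lemma white_wpos s : (s < wrank p k)%N -> white p (wpos p s).
Proof.
move=> sk; suff : wpos p s \in [seq x <- iota 0 (size p) | white p x].
  by rewrite mem_filter => /andP[].
by apply: mem_nth; rewrite size_filter (mp_size mp).
Qed.

Lemma wrank_wpos s : (s < wrank p k)%N -> wrank p (wpos p s) = s.
Proof.
move=> sk; have ws := white_wpos sk; have lt := wrank_ltn ws.
have /eqP := wposK ws; rewrite {1}/wpos [X in _ == X]/wpos.
rewrite nth_uniq ?filter_uniq ?iota_uniq ?size_filter ?(mp_size mp) //.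
by move/eqP.
Qed.

Lemma wpos_lt s : (s < wrank p k)%N -> (wpos p s < k)%N.
Proof. by move/white_wpos/white_lt. Qed.

End Wpos.

(** The increasing map that misses [t] and [t.+1]: it sends the rank of a white vertex after the
    removal of two whites to its rank before. *)
Definition skip2 (t s : nat) : nat := if (s < t)%N then s else s.+2.

Lemma skip2E t s : skip2 t s = (s + 2 * (t <= s))%N.
Proof. by rewrite /skip2; case: ltnP; lia. Qed.

Section WposCup.
Variables (k : nat) (b b' : seq int) (t : nat).
Hypotheses (mb : motzkin_path k b) (mb' : motzkin_path k b').
Hypothesis tb : (t.+1 < wrank b k)%N.
Hypothesis wb' : forall x, white b' x = [&& white b x, x != wpos b t & x != wpos b t.+1].

Let wt : wrank b (wpos b t) = t. Proof. by apply: (wrank_wpos mb); lia. Qed.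
Let wt1 : wrank b (wpos b t.+1) = t.+1. Proof. exact: (wrank_wpos mb). Qed.
Let wht : white b (wpos b t). Proof. by apply: (white_wpos mb); lia. Qed.
Let wht1 : white b (wpos b t.+1). Proof. exact: (white_wpos mb). Qed.

Lemma wpos_ltS : (wpos b t < wpos b t.+1)%N.
Proof. by rewrite ltnNge; apply/negP => /(leq_wrank b); rewrite wt wt1 ltnn. Qed.

Lemma wrank_skip x :
  (wrank b' x + (wpos b t < x) + (wpos b t.+1 < x))%N = wrank b x.
Proof.
have acl := wpos_ltS; elim: x => [|x IH]; first by rewrite /wrank.
rewrite !wrankS wb' -IH.
have [xt|xt] := eqVneq x (wpos b t); first by rewrite xt wht; lia.
have [xt'|xt'] := eqVneq x (wpos b t.+1); first by rewrite xt' wht1; lia.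
by rewrite !andbT; move: xt xt'; lia.
Qed.

Lemma wrank_skip_size : (wrank b' k).+2 = wrank b k.
Proof.
by rewrite -wrank_skip; have := wpos_lt mb tb; have := wpos_ltS; lia.
Qed.

(** Only the white vertices of [b'] are prescribed, not its edges, so that the lemma serves [cup]
    and [pdot] alike. *)
Lemma wpos_skip s : (s < wrank b' k)%N -> wpos b' s = wpos b (skip2 t s).
Proof.
have sz := wrank_skip_size => sk.
have lt : (skip2 t s < wrank b k)%N by rewrite skip2E; lia.
have ws := white_wpos mb lt; have es := wrank_wpos mb lt.
have w's : white b' (wpos b (skip2 t s)).
  rewrite wb' ws /=; apply/andP; split; apply/eqP => e; move: es; rewrite e ?wt ?wt1 skip2E; lia.
rewrite -[in RHS](wposK mb' w's); congr wpos.
have := wrank_skip (wpos b (skip2 t s)); rewrite es.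
have : (wpos b t < wpos b (skip2 t s))%N = (t <= s)%N.
  apply/idP/idP => h; first by have := ltn_wrank wht h; rewrite es wt skip2E; lia.
  by rewrite ltnNge; apply/negP => /(leq_wrank b); rewrite es wt skip2E; lia.
have : (wpos b t.+1 < wpos b (skip2 t s))%N = (t <= s)%N.
  apply/idP/idP => h; first by have := ltn_wrank wht1 h; rewrite es wt1 skip2E; lia.
  by rewrite ltnNge; apply/negP => /(leq_wrank b); rewrite es wt1 skip2E; lia.
by move=> -> ->; rewrite skip2E; lia.
Qed.

End WposCup.

(** * Graphs with noncrossing ends *)

Lemma connect_ind (V : finType) (e : rel V) (P : V -> Prop) u v :
  (forall x y, e x y -> P x -> P y) -> P u -> connect e u v -> P v.
Proof.
move=> step Pu /connectP[p]; elim: p u Pu => [|w p IH] u Pu /= => [_ -> //|].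
by case/andP => /step/(_ Pu)/IH.
Qed.

Section AddEdge.
Variables (V : finType) (e : rel V).
Implicit Types (u v a c : V).

Definition add_edge a c : rel V :=
  fun x y => [|| e x y, (x == a) && (y == c) | (x == c) && (y == a)].

Hypothesis sym_e : symmetric e.

Lemma connect_symC : connect_sym e.
Proof. exact: sym_connect_sym. Qed.

Lemma symmetric_add_edge a c : symmetric (add_edge a c).
Proof. by move=> x y; rewrite /add_edge sym_e ![(_ == a) && _]andbC (orbC (_ && (y == a))). Qed.

Lemma connect_add_edge a c u v : connect (add_edge a c) u v =
  [|| connect e u v, connect e u a && connect e c v | connect e u c && connect e a v].
Proof.
have sub x y : connect e x y -> connect (add_edge a c) x y.
  by apply: connect_sub => {}x {}y exy; apply: connect1; rewrite /add_edge exy.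
have ac : connect (add_edge a c) a c by apply: connect1; rewrite /add_edge !eqxx orbT.
have ca : connect (add_edge a c) c a by apply: connect1; rewrite /add_edge !eqxx !orbT.
apply/idP/idP.
  apply: (@connect_ind _ _ (fun w => [|| connect e u w, connect e u a && connect e c w
    | connect e u c && connect e a w])) => [x y|]; last by rewrite connect0.
  case/or3P => [exy|/andP[/eqP-> /eqP->]|/andP[/eqP-> /eqP->]].
  - have tr z : connect e z x -> connect e z y.
      by move=> zx; apply: connect_trans zx (connect1 exy).
    case/or3P => [/tr ->//|/andP[-> /tr ->]|/andP[-> /tr ->]]; by rewrite ?orbT.
  - case/or3P => [->|/andP[-> _]|/andP[-> _]]; by rewrite ?connect0 ?orbT.
  - case/or3P => [->|/andP[-> _]|/andP[-> _]]; by rewrite ?connect0 ?orbT.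
case/or3P => [/sub //|/andP[/sub ua /sub cv]|/andP[/sub uc /sub av]].
  exact: connect_trans ua (connect_trans ac cv).
exact: connect_trans uc (connect_trans ca av).
Qed.

End AddEdge.

(* In the union of two matchings every vertex unmatched on one side is an end of
   its component on that side (an isolated vertex is an end twice), and every
   component is either a cycle or has exactly two ends.  The white ends sit on a
   circle at the positions [pos]; planarity says that their pairing does not cross. *)
Record noncrossing_ends (V : finType) (pos : V * bool -> nat)
    (e : rel V) (E W : pred (V * bool)) : Prop := NoncrossingEnds {
  ne_sym : symmetric e;
  ne_sub : forall A, W A -> E A;
  ne_mate : forall A, E A -> exists B, [/\ E B, B != A & connect e A.1 B.1];
  ne_uniq : forall A B C, E A -> E B -> E C -> connect e A.1 B.1 ->
    connect e A.1 C.1 -> B != A -> C != A -> B = C;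
  ne_nc : forall A B C D, W A -> W B -> W C -> W D -> connect e A.1 B.1 ->
    connect e C.1 D.1 -> ~~ [&& pos A < pos C, pos C < pos B & pos B < pos D]%N }.

Section Surgery.
Variables (V : finType) (pos : V * bool -> nat).
Hypothesis pos_inj : injective pos.
Variables (e : rel V) (E W : pred (V * bool)).
Hypothesis ne : noncrossing_ends pos e E W.
Variables (A0 C0 : V * bool).
Hypotheses (WA0 : W A0) (WC0 : W C0) (nAC : A0 != C0).
Hypothesis between : forall X, W X ->
  ~~ (pos A0 < pos X < pos C0)%N && ~~ (pos C0 < pos X < pos A0)%N.

Let drop (F : pred (V * bool)) : pred (V * bool) :=
  fun X => [&& F X, X != A0 & X != C0].
Local Notation e' := (add_edge e A0.1 C0.1).
Local Notation "x ~~> y" := (connect e x.1 y.1) (at level 70).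

Let sym x y : connect e x y = connect e y x.
Proof. exact: connect_symC (ne_sym ne) _ _. Qed.

(** Joining [X] to [Y] hands the mate of [Y] over to [A], the former mate of [X]. That mate is
    neither [X] nor [A], since a component has only two ends and these two already share one. *)
Let mate_surgery X Y A : E X -> E Y -> X != Y -> E A -> A != X -> A != Y ->
  A ~~> X -> exists B, [/\ [&& E B, B != X & B != Y], B != A & Y ~~> B].
Proof.
move=> EX EY nXY EA AX AY cAX; have [D [ED DY cYD]] := ne_mate ne EY.
exists D; split=> //; last first.
  apply/eqP => DA; subst D; have := @ne_uniq _ _ _ _ _ ne A X Y EA EX EY cAX.
  by rewrite sym => /(_ cYD); rewrite eq_sym AX eq_sym AY => /(_ isT isT) /eqP; rewrite (negPf nXY).
rewrite ED DY andbT /=; apply/eqP => DX; subst D.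
have := @ne_uniq _ _ _ _ _ ne X A Y EX EA EY; rewrite sym => /(_ cAX).
by rewrite sym => /(_ cYD AX); rewrite eq_sym => /(_ nXY) /eqP; rewrite (negPf AY).
Qed.

(** No white end lies between [A0] and [C0] on the circle, so any other position sees both from the
    same side. A crossing that involves the merged strand would therefore be a crossing with one of
    the two old strands it consists of. *)
Lemma noncrossing_ends_add_edge :
  noncrossing_ends pos e' (drop E) (drop W).
Proof.
have EA0 := ne_sub ne WA0; have EC0 := ne_sub ne WC0.
have uni X Y Z : E X -> E Y -> E Z -> X ~~> Y -> X ~~> Z -> Y != X -> Z != X -> Y = Z.
  exact: (@ne_uniq _ _ _ _ _ ne X Y Z).
have cE x y := @connect_add_edge V e A0.1 C0.1 x y.
split.
- exact: symmetric_add_edge (ne_sym ne) _ _.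
- by move=> A /and3P[WA nA nC]; rewrite /drop (ne_sub ne WA) nA nC.
- move=> A /and3P[EA nA nC]; have [B [EB BA cAB]] := ne_mate ne EA.
  have [BA0|BA0] := eqVneq B A0.
    subst B; have [D [ED DA cD]] := mate_surgery EA0 EC0 nAC EA nA nC cAB.
    by exists D; split=> //; rewrite cE cAB cD orbT.
  have [BC0|BC0] := eqVneq B C0.
    subst B; have nCA := nAC; rewrite eq_sym in nCA.
    have [D [/and3P[ED D1 D2] DA cD]] := mate_surgery EC0 EA0 nCA EA nC nA cAB.
    by exists D; split=> //; rewrite /drop ?ED ?D1 ?D2 // cE cAB cD !orbT.
  by exists B; rewrite /drop EB BA0 BC0 BA cE cAB.
- move=> A B C /and3P[EA A1 A2] /and3P[EB B1 B2] /and3P[EC C1 C2]; rewrite !cE.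
  have nAC' := nAC; rewrite eq_sym in nAC'.
  have [A1' A2'] : A0 != A /\ C0 != A by rewrite ![_ == A]eq_sym.
  move=> /or3P[cB|/andP[cA cB]|/andP[cA cB]] /or3P[cC|/andP[cA' cC]|/andP[cA' cC]] BA CA.
  + exact: uni cB cC BA CA.
  + by move: B1; rewrite (uni _ _ _ EA EB EA0 cB cA' BA A1') eqxx.
  + by move: B2; rewrite (uni _ _ _ EA EB EC0 cB cA' BA A2') eqxx.
  + by move: C1; rewrite (uni _ _ _ EA EC EA0 cC cA CA A1') eqxx.
  + exact: uni cB cC B2 C2.
  + by move: nAC; rewrite (uni _ _ _ EA EA0 EC0 cA cA' A1' A2') eqxx.
  + by move: C2; rewrite (uni _ _ _ EA EC EC0 cC cA CA A2') eqxx.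
  + by move: nAC; rewrite (uni _ _ _ EA EA0 EC0 cA' cA A1' A2') eqxx.
  + exact: uni cB cC B1 C1.
have nc X Y Z T : W X -> W Y -> W Z -> W T -> X ~~> Y -> Z ~~> T ->
    ~~ [&& pos X < pos Z, pos Z < pos Y & pos Y < pos T]%N.
  exact: (@ne_nc _ _ _ _ _ ne).
have btw X : W X -> X != A0 -> X != C0 ->
    [&& pos X != pos A0, pos X != pos C0, ~~ (pos A0 < pos X < pos C0)%N & ~~ (pos C0 < pos X < pos A0)%N].
  by move=> WX X1 X2; rewrite !(inj_eq pos_inj) X1 X2 between.
have nAC' : pos A0 != pos C0 by rewrite (inj_eq pos_inj).
have triple X Y Z : E X -> E Y -> E Z -> X ~~> Y -> X ~~> Z -> Y != X -> Z != X -> Y != Z -> False.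
  by move=> EX EY EZ XY XZ YX ZX; rewrite (uni X Y Z) ?eqxx.
move=> A B C D /and3P[WA A1 A2] /and3P[WB B1 B2] /and3P[WC C1 C2] /and3P[WD D1 D2]; rewrite !cE => hAB hCD.
have bA := btw _ WA A1 A2; have bB := btw _ WB B1 B2.
have bC := btw _ WC C1 C2; have bD := btw _ WD D1 D2.
have [EA EB EC ED] : [/\ E A, E B, E C & E D] by split; apply: (ne_sub ne).
apply/negP => /and3P[AC CB BD].
have [AnC AnD] : A != C /\ A != D.
  split; apply/eqP => ee; first by rewrite ee ltnn in AC.
  by have := ltn_trans AC (ltn_trans CB BD); rewrite ee ltnn.
(* Each strand is old or passes through the new edge in one of two directions. One old strand
   against a new one contradicts three instances of the old planarity; two new ones would put three
   ends on one component. *)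
case/or3P: hAB => [cB|/andP[cA cB]|/andP[cA cB]]; case/or3P: hCD => [cD|/andP[cC cD]|/andP[cC cD]].
- by have := nc _ _ _ _ WA WB WC WD cB cD; rewrite AC CB BD.
- have n1 := nc _ _ _ _ WA WB WC WA0 cB cC; have n3 := nc _ _ _ _ WA WB WC0 WD cB cD.
  rewrite sym in cC; have n2 := nc _ _ _ _ WA0 WC WA WB cC cB.
  by clear -n1 n2 n3 bA bB AC CB BD nAC'; lia.
- have n1 := nc _ _ _ _ WA WB WC WC0 cB cC; have n3 := nc _ _ _ _ WA WB WA0 WD cB cD.
  rewrite sym in cC; have n2 := nc _ _ _ _ WC0 WC WA WB cC cB.
  by clear -n1 n2 n3 bA bB AC CB BD nAC'; lia.
- have n1 := nc _ _ _ _ WA WA0 WC WD cA cD; have n3 := nc _ _ _ _ WC0 WB WC WD cB cD.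
  rewrite sym in cB; have n2 := nc _ _ _ _ WC WD WB WC0 cD cB.
  by clear -n1 n2 n3 bC bD AC CB BD nAC'; lia.
- by rewrite sym in cA; rewrite sym in cC; apply: (triple A0 A C).
- by rewrite sym in cA; apply: (triple A0 A D).
- have n1 := nc _ _ _ _ WA WC0 WC WD cA cD; have n3 := nc _ _ _ _ WA0 WB WC WD cB cD.
  rewrite sym in cB; have n2 := nc _ _ _ _ WC WD WB WA0 cD cB.
  by clear -n1 n2 n3 bC bD AC CB BD nAC'; lia.
- by rewrite sym in cA; apply: (triple C0 A D).
- by rewrite sym in cA; rewrite sym in cC; apply: (triple C0 A C).
Qed.

End Surgery.

(** * Counting cycles *)

Section Loops.
Variable V : finType.
Implicit Types (e : rel V) (good : pred V) (E : pred (V * bool)).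

Definition component e v : {set V} := [set w | connect e v w].

Definition loops e good : nat :=
  #|[set component e v | v in [pred v | component e v \subset good]]|.

Lemma eq_loops e1 e2 good1 good2 :
  e1 =2 e2 -> good1 =1 good2 -> loops e1 good1 = loops e2 good2.
Proof.
move=> ee eg; have ec v : component e1 v = component e2 v.
  by apply/setP => w; rewrite !inE (eq_connect ee).
have gg : good1 =i good2 by move=> w; rewrite -!topredE /= eg.
rewrite /loops; congr #|pred_of_set _|; apply/setP => C.
have sub v : (component e1 v \subset good1) = (component e2 v \subset good2).
  by rewrite ec; apply: eq_subset_r.
apply/imsetP/imsetP => -[v]; rewrite inE => vg ->; exists v; rewrite ?ec // inE.
  by rewrite -sub.
by rewrite sub.
Qed.

Lemma component_eq e v w : connect_sym e -> connect e v w -> component e v = component e w.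
Proof.
by move=> sym vw; apply/setP => z; rewrite !inE; apply: same_connect.
Qed.

Lemma mem_component e v : v \in component e v.
Proof. by rewrite inE connect0. Qed.

Lemma component_inj e v w : connect_sym e -> component e v = component e w -> connect e v w.
Proof. by move=> sym vw; have := mem_component e w; rewrite -vw inE. Qed.

(** These vertices are matched on both sides; a component made up of them alone is a closed loop. *)
Definition cyclic_vertex E : pred V := [pred v | ~~ E (v, true) && ~~ E (v, false)].

Lemma cyclic_vertexPn E v : reflect (exists s, E (v, s)) (v \notin cyclic_vertex E).
Proof.
rewrite inE /= negb_and !negbK; apply: (iffP orP) => [[]|[[]]]; first by exists true.
- by exists false.
- by left.
- by right.
Qed.

End Loops.

(** Used to pass from the three-level stack to its middle row, and to delete a last vertex that
    carries no edge. Hence [h] has to reach only the good vertices. *)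
Lemma loops_transfer (V V' : finType) (h : V' -> V) (e : rel V) (e' : rel V')
    (good : pred V) (good' : pred V') :
  injective h -> (forall x y, connect e (h x) (h y) = connect e' x y) ->
  (forall x, good (h x) = good' x) -> (forall v, good v -> exists x, v = h x) ->
  (forall x w, component e' x \subset good' -> connect e (h x) w -> exists y, w = h y) ->
  loops e good = loops e' good'.
Proof.
move=> hinj hc hg gh ch; rewrite /loops.
rewrite -[RHS](card_imset _ (imset_inj hinj)); congr #|pred_of_set _|.
have comp_h x : component e' x \subset good' -> h @: component e' x = component e (h x).
  move=> xg; apply/setP => w; rewrite inE; apply/imsetP/idP => [[y]|hw].
    by rewrite inE => xy ->; rewrite hc.
  by have [y wy] := ch _ _ xg hw; exists y; rewrite // inE -hc -wy.
apply/setP => C; apply/imsetP/imsetP => [[v]|[D /imsetP[x]]]; rewrite inE => vg.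
  have /gh[x vx] : good v by apply: (subsetP vg); rewrite mem_component.
  have xg : component e' x \subset good'.
    apply/subsetP => y; rewrite inE -hc -vx => vy; rewrite -topredE /= -hg.
    by apply: (subsetP vg); rewrite inE.
  move=> ->; exists (component e' x); first by apply/imsetP; exists x; rewrite ?inE.
  by rewrite comp_h // vx.
move=> -> ->; exists (h x); rewrite ?comp_h // inE -comp_h //.
by apply/subsetP => _ /imsetP[y /(subsetP vg) yg ->]; rewrite -topredE /= hg.
Qed.

Section LoopsSurgery.
Variables (V : finType) (pos : V * bool -> nat).
Variables (e : rel V) (E W : pred (V * bool)).
Hypothesis ne : noncrossing_ends pos e E W.
Variables (A0 C0 : V * bool).
Hypotheses (WA0 : W A0) (WC0 : W C0) (nAC : A0 != C0).

Let E' : pred (V * bool) := fun X => [&& E X, X != A0 & X != C0].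
Local Notation e' := (add_edge e A0.1 C0.1).

(** Joining the two ends of one strand turns it into exactly one new cycle; joining ends of
    different strands yields a longer strand and no cycle. *)
Lemma loops_add_edge : loops e' (cyclic_vertex E') =
  (loops e (cyclic_vertex E) + connect e A0.1 C0.1)%N.
Proof.
have EA0 := ne_sub ne WA0; have EC0 := ne_sub ne WC0.
have sym : connect_sym e := connect_symC (ne_sym ne).
have sym' : connect_sym e' by apply: connect_symC; apply: symmetric_add_edge (ne_sym ne) _ _.
have cE x y := @connect_add_edge V e A0.1 C0.1 x y.
have cA : A0.1 \notin cyclic_vertex E.
  by apply/cyclic_vertexPn; exists A0.2; rewrite -surjective_pairing.
have cC : C0.1 \notin cyclic_vertex E.
  by apply/cyclic_vertexPn; exists C0.2; rewrite -surjective_pairing.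
have cyc' v : v != A0.1 -> v != C0.1 -> (v \in cyclic_vertex E') = (v \in cyclic_vertex E).
  move=> vA vC; rewrite !inE /= /E'.
  have dr (s : bool) (X : V * bool) : v != X.1 -> ((v, s) != X) by apply: contra => /eqP <-.
  by rewrite !(dr _ A0) // !(dr _ C0) // !andbT.
have comp_far v : ~~ connect e v A0.1 -> ~~ connect e v C0.1 ->
    component e' v = component e v /\
    (component e v \subset cyclic_vertex E') = (component e v \subset cyclic_vertex E).
  move=> vA vC; split.
    by apply/setP => w; rewrite !inE cE (negPf vA) (negPf vC) /= orbF.
  have out w : w \in component e v -> w != A0.1 /\ w != C0.1.
    by rewrite inE => vw; split; apply: contraTneq vw => ->.
  apply/subsetP/subsetP => sub w wv; have [wA wC] := out w wv.
    by rewrite -cyc' // sub.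
  by rewrite cyc' // sub.
rewrite /loops; case con: (connect e A0.1 C0.1); last first.
  (* The mate of [A0] is not [C0] here, so it remains an end of the merged component. *)
  have bad v : connect e v A0.1 || connect e v C0.1 ->
      (component e' v \subset cyclic_vertex E') = false.
    move=> vAC; have [B [EB BA cB]] := ne_mate ne EA0.
    have BC : B != C0 by apply: contraFneq con => <-.
    apply/negP => /subsetP /(_ B.1); rewrite inE cE.
    case/orP: vAC => [vA|vC].
      rewrite (connect_trans vA cB) => /(_ isT); apply/negP/cyclic_vertexPn.
      by exists B.2; rewrite -surjective_pairing /E' EB BA BC.
    rewrite vC cB !orbT => /(_ isT); apply/negP/cyclic_vertexPn.
    by exists B.2; rewrite -surjective_pairing /E' EB BA BC.
  have bad0 v : connect e v A0.1 || connect e v C0.1 ->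
      (component e v \subset cyclic_vertex E) = false.
    move=> vAC; apply/negP => /subsetP h; case/orP: vAC => vx.
      by move: cA; rewrite h // inE.
    by move: cC; rewrite h // inE.
  rewrite addn0; congr #|pred_of_set _|; apply/setP => C; apply/imsetP/imsetP => -[v]; rewrite inE.
    case/boolP: (connect e v A0.1 || connect e v C0.1) => [/bad -> //|].
    rewrite negb_or => /andP[vA vC]; have [-> ->] := comp_far v vA vC => vE ->.
    by exists v; rewrite ?inE.
  case/boolP: (connect e v A0.1 || connect e v C0.1) => [/bad0 -> //|].
  rewrite negb_or => /andP[vA vC]; have [<- <-] := comp_far v vA vC => vE ->.
  by exists v; rewrite ?inE.
have comp' v : component e' v = component e v.
  apply/setP => w; rewrite !inE cE; apply/idP/idP => [|->//].
  case/or3P => // /andP[h1 h2]; first by apply: connect_trans h1 (connect_trans con h2).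
  by rewrite sym in con; apply: connect_trans h1 (connect_trans con h2).
(* The only ends on this component are [A0] and [C0], and the new edge uses up both. *)
have goodA : component e A0.1 \subset cyclic_vertex E'.
  apply/subsetP => w; rewrite inE => Aw; apply/negPn/negP => /cyclic_vertexPn[s /and3P[Ew wA wC]].
  have := @ne_uniq _ _ _ _ _ ne A0 (w, s) C0 EA0 Ew EC0 Aw con wA.
  by rewrite eq_sym => /(_ nAC) h; rewrite h eqxx in wC.
rewrite addn1.
have -> : [set component e' v | v in [pred v | component e' v \subset cyclic_vertex E']] =
   component e A0.1 |: [set component e v | v in [pred v | component e v \subset cyclic_vertex E]].
  apply/setP => C; rewrite in_setU1; apply/imsetP/orP => [[v]|].
    rewrite inE comp' => vE ->.
    have [vA|vA] := boolP (connect e v A0.1); first by left; rewrite (component_eq sym vA).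
    have vC : ~~ connect e v C0.1.
      by apply: contra vA => vC; rewrite sym in con; apply: connect_trans vC con.
    right; apply/imsetP; exists v => //; rewrite inE.
    by have [_ <-] := comp_far v vA vC.
  case=> [/eqP ->|/imsetP[v]].
    by exists A0.1; rewrite ?comp' // inE comp'.
  rewrite inE => vE ->; exists v; rewrite ?comp' // inE comp'.
  have [vA|vA] := boolP (connect e v A0.1); first by rewrite (component_eq sym vA).
  have vC : ~~ connect e v C0.1.
    by apply: contra vA => vC; rewrite sym in con; apply: connect_trans vC con.
  by have [_ ->] := comp_far v vA vC.
rewrite cardsU1; case: imsetP => //= -[v]; rewrite inE => vE Av.
by move: cA; rewrite (subsetP vE) // -Av mem_component.
Qed.

End LoopsSurgery.

(** * Superposition of two 1-factors *)

Lemma noncrossing_ends_ext (V : finType) (pos : V * bool -> nat) (e1 e2 : rel V)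
    (E1 E2 W1 W2 : pred (V * bool)) : e1 =2 e2 -> E1 =1 E2 -> W1 =1 W2 ->
  noncrossing_ends pos e1 E1 W1 -> noncrossing_ends pos e2 E2 W2.
Proof.
move=> ee EE WW [s1 s2 s3 s4 s5]; split.
- by move=> x y; rewrite -!ee.
- by move=> A; rewrite -EE -WW; apply: s2.
- move=> A; rewrite -EE => /s3[B [EB BA cAB]]; exists B.
  by rewrite -EE -(eq_connect ee).
- by move=> A B C; rewrite -!EE -!(eq_connect ee); apply: s4.
- by move=> A B C D; rewrite -!WW -!(eq_connect ee); apply: s5.
Qed.

(* The factor p is drawn above and q below the row of vertices; the boundary circle
   meets the rays of p from left to right and then those of q from right to left. *)
Definition circle_pos k (A : 'I_k * bool) : nat := if A.2 then val A.1 else (k.*2 - A.1)%N.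

Lemma circle_pos_inj k : injective (@circle_pos k).
Proof.
move=> [x s] [y t]; rewrite /circle_pos /=; have := ltn_ord x; have := ltn_ord y.
case: s; case: t => h1 h2 h3; try by exfalso; lia.
  by rewrite (val_inj h3).
by congr (_, _); apply: val_inj; rewrite /=; lia.
Qed.

Section MidGraph.
Variable k : nat.
Implicit Types p q b : seq int.

(** This is the middle row of [d_p^p] stacked above [d_q^q]: it carries the bottom edges p of the
    former and the top edges q of the latter. *)
Definition mid p q : rel 'I_k := fun x y => pedge p x y || pedge q x y.
(** An end is a white vertex or an isolated black one. Black ends make a strand a dead end: they
    matter for telling cycles from strands, but not for planarity, which concerns [whites] only. *)
Definition ends p q : pred ('I_k * bool) :=
  fun A => ~~ [exists y : 'I_k, pedge (if A.2 then p else q) A.1 y].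
Definition whites p q : pred ('I_k * bool) :=
  fun A => white (if A.2 then p else q) A.1.
Definition mid_loops p q : nat := loops (mid p q) (cyclic_vertex (ends p q)).

Lemma pedge_sym p : symmetric (pedge p).
Proof. by move=> x y; rewrite /pedge orbC. Qed.

Lemma mid_symmetric p q : symmetric (mid p q).
Proof. by move=> x y; rewrite /mid !(pedge_sym _ x). Qed.

Lemma midC p q : mid p q =2 mid q p.
Proof. by move=> x y; rewrite /mid orbC. Qed.

Lemma mid_loopsC p q : mid_loops p q = mid_loops q p.
Proof.
apply: eq_loops => [|v]; first exact: midC.
by rewrite /cyclic_vertex /= /ends /= andbC.
Qed.

Lemma white_no_pedge p x y : motzkin_path k p -> white p x -> pedge p x y = false.
Proof.
move=> mp wx; apply/negP => /(pedgeP mp)[/(arch_white mp)|/(arch_white mp)]; by rewrite wx ?andbF.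
Qed.

Section Cup.
Variables (p b : seq int) (a c : 'I_k).
Hypotheses (mb : motzkin_path k b) (wa : white b a) (wc : white b c).
Hypothesis ac : wrank b c = (wrank b a).+1.

Let acl : (a < c)%N. Proof. by have := cup_lt mb wa wc ac; lia. Qed.

Lemma has_pedge_cup (x : 'I_k) : [exists y : 'I_k, pedge (cup b c) x y] =
  [|| [exists y : 'I_k, pedge b x y], x == a | x == c].
Proof.
apply/existsP/idP => [[y]|].
  rewrite (pedge_cup mb wa wc ac) => /orP[/orP[xy|/andP[/eqP xa _]]|/andP[/eqP xc _]].
  - by apply/orP; left; apply/existsP; exists y.
  - by rewrite (val_inj xa) eqxx orbT.
  - by rewrite (val_inj xc) eqxx !orbT.
case/or3P => [/existsP[y xy]|/eqP->|/eqP->].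
- by exists y; rewrite (pedge_cup mb wa wc ac) xy.
- by exists c; rewrite (pedge_cup mb wa wc ac) !eqxx orbT.
- by exists a; rewrite (pedge_cup mb wa wc ac) !eqxx orbT.
Qed.

Lemma mid_cupr : mid p (cup b c) =2 add_edge (mid p b) a c.
Proof.
by move=> x y; rewrite /mid /add_edge (pedge_cup mb wa wc ac) -!val_eqE !orbA.
Qed.

Lemma mid_cupl : mid (cup b c) p =2 add_edge (mid b p) a c.
Proof. by move=> x y; rewrite midC mid_cupr /add_edge midC. Qed.

Lemma ends_cupr X :
  ends p (cup b c) X = [&& ends p b X, X != (a, false) & X != (c, false)].
Proof.
case: X => x [] /=; rewrite /ends /= ?xpair_eqE ?andbF ?andbT //.
by rewrite has_pedge_cup !negb_or.
Qed.

Lemma ends_cupl X :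
  ends (cup b c) p X = [&& ends b p X, X != (a, true) & X != (c, true)].
Proof.
case: X => x [] /=; rewrite /ends /= ?xpair_eqE ?andbF ?andbT //.
by rewrite has_pedge_cup !negb_or.
Qed.

Lemma whites_cupr X :
  whites p (cup b c) X = [&& whites p b X, X != (a, false) & X != (c, false)].
Proof.
case: X => x [] /=; rewrite /whites /= ?xpair_eqE ?andbF ?andbT //.
by rewrite (white_cup mb wa wc ac).
Qed.

Lemma whites_cupl X :
  whites (cup b c) p X = [&& whites b p X, X != (a, true) & X != (c, true)].
Proof.
case: X => x [] /=; rewrite /whites /= ?xpair_eqE ?andbF ?andbT //.
by rewrite (white_cup mb wa wc ac).
Qed.

Lemma noncrossing_ends_cupr :
  noncrossing_ends (@circle_pos k) (mid p b) (ends p b) (whites p b) ->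
  noncrossing_ends (@circle_pos k) (mid p (cup b c)) (ends p (cup b c)) (whites p (cup b c)).
Proof.
move=> ne; have := @noncrossing_ends_add_edge _ _ (@circle_pos_inj k) _ _ _ ne (a, false) (c, false) wa wc.
move=> h; apply: noncrossing_ends_ext (h _ _).
- by move=> x y; rewrite mid_cupr.
- by move=> X; rewrite ends_cupr.
- by move=> X; rewrite whites_cupr.
- by rewrite xpair_eqE andbT -val_eqE /=; lia.
move=> [x []] wx; rewrite /circle_pos /=; have := ltn_ord x; have := ltn_ord a; have := ltn_ord c; first lia.
by have := @white_between _ _ _ _ mb wa wc ac x wx; lia.
Qed.

Lemma noncrossing_ends_cupl :
  noncrossing_ends (@circle_pos k) (mid b p) (ends b p) (whites b p) ->
  noncrossing_ends (@circle_pos k) (mid (cup b c) p) (ends (cup b c) p) (whites (cup b c) p).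
Proof.
move=> ne; have := @noncrossing_ends_add_edge _ _ (@circle_pos_inj k) _ _ _ ne (a, true) (c, true) wa wc.
move=> h; apply: noncrossing_ends_ext (h _ _).
- by move=> x y; rewrite mid_cupl.
- by move=> X; rewrite ends_cupl.
- by move=> X; rewrite whites_cupl.
- by rewrite xpair_eqE andbT -val_eqE /=; lia.
move=> [x []] wx; rewrite /circle_pos /=; have := ltn_ord x; have := ltn_ord a; have := ltn_ord c; last lia.
by have := @white_between _ _ _ _ mb wa wc ac x wx; lia.
Qed.

Lemma mid_loops_cupr :
  noncrossing_ends (@circle_pos k) (mid p b) (ends p b) (whites p b) ->
  mid_loops p (cup b c) = (mid_loops p b + connect (mid p b) a c)%N.
Proof.
move=> ne; rewrite -(@loops_add_edge _ _ _ _ _ ne (a, false) (c, false)) //; last first.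
  by rewrite xpair_eqE andbT -val_eqE /=; lia.
apply: eq_loops => [x y|v]; first exact: mid_cupr.
by rewrite /cyclic_vertex /= !ends_cupr.
Qed.

Lemma mid_dotsr : mid p (pdot b a c) =2 mid p b.
Proof. by move=> x y; rewrite /mid (pedge_dots mb wa wc ac). Qed.

Lemma mid_loops_dotsr : mid_loops p (pdot b a c) = mid_loops p b.
Proof.
apply: eq_loops => [|v]; first exact: mid_dotsr.
rewrite /cyclic_vertex /= /ends /=; congr (_ && ~~ ~~ _).
by apply: eq_existsb => y; rewrite (pedge_dots mb wa wc ac).
Qed.

End Cup.

Lemma psum_le p n : motzkin_path k p -> psum p n <= n%:Z.
Proof.
by move=> mp; elim: n => [|n IH]; [rewrite psum0 | have := step_psum mp n; lia].
Qed.

Lemma last_down p : motzkin_path k p -> (forall n, p`_n != -1) \/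
  exists c : 'I_k, p`_c = -1 /\ (forall n, (c < n)%N -> p`_n != -1).
Proof.
move=> mp; have out n : p`_n == -1 -> (n <= k)%N.
  by case: (leqP n k) => // kn; rewrite nth_default // (mp_size mp) ltnW.
case: (pickP (fun n : 'I_k => p`_n == -1)) => [n pn|no]; last first.
  left=> n; have [nk|nk] := ltnP n k; first by rewrite (no (Ordinal nk)).
  by rewrite nth_default // (mp_size mp).
right; have ex : exists n, p`_n == -1 by exists n.
case: (ex_maxnP ex out) => c /eqP pc cmax.
have ck : (c < k)%N.
  by case: (ltnP c k) => // kc; move: pc; rewrite nth_default // (mp_size mp).
exists (Ordinal ck); split=> // m cm; apply/negP => /cmax; rewrite /= in cm; lia.
Qed.

Lemma no_down_pedge p x y : motzkin_path k p -> (forall n, p`_n != -1) -> pedge p x y = false.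
Proof.
move=> mp no; apply/negP => /(pedgeP mp)[] /(arch_step mp)[_ /eqP]; by rewrite (negPf (no _)).
Qed.

(** Induction on 2k minus the two final heights, which drops by 2 when the last -1 of a path is
    raised to 1. Without any -1 there are no edges: each vertex is a component with its own two
    sides as ends, and the chords join the mirror positions x and 2k - x, which are nested. *)
Lemma mid_noncrossing p q : motzkin_path k p -> motzkin_path k q ->
  noncrossing_ends (@circle_pos k) (mid p q) (ends p q) (whites p q).
Proof.
move=> mp mq; have [n] := ubnP (absz ((k.*2)%:Z - psum p k - psum q k)%R).
elim: n p q mp mq => // n IH p q mp mq le.
have lp := psum_le k mp; have lq := psum_le k mq; have k2 : k.*2 = (k + k)%N by rewrite addnn.
have [dp|[c [pc after]]] := last_down mp; last first.
  have [a [mb wa wc ac [ecup _]]] := uncup mp (ltn_ord c) pc after.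
  set b := set_nth 0 p c 1 in mb wa wc ac ecup.
  have hb : psum b k = psum p k + 2 by rewrite psum_set_nth pc ltn_ord; lia.
  have lb := psum_le k mb.
  rewrite -ecup; apply: (@noncrossing_ends_cupl q b (Ordinal (white_lt mb wa)) c mb wa wc ac).
  by apply: IH => //; move: le; lia.
have [dq|[c [qc after]]] := last_down mq; last first.
  have [a [mb wa wc ac [ecup _]]] := uncup mq (ltn_ord c) qc after.
  set b := set_nth 0 q c 1 in mb wa wc ac ecup.
  have hb : psum b k = psum q k + 2 by rewrite psum_set_nth qc ltn_ord; lia.
  have lb := psum_le k mb.
  rewrite -ecup; apply: (@noncrossing_ends_cupr p b (Ordinal (white_lt mb wa)) c mb wa wc ac).
  by apply: IH => //; move: le; lia.
have none x y : mid p q x y = false by rewrite /mid !no_down_pedge.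
have conE x y : connect (mid p q) x y = (x == y).
  apply/idP/eqP => [|->//].
  by apply: (@connect_ind _ _ (fun w => x = w)) => [u v|//]; rewrite none.
have endT A : ends p q A.
  by apply/existsP => -[y]; case: ifP => _; rewrite no_down_pedge.
split.
- exact: mid_symmetric.
- by [].
- move=> [x s] _; exists (x, ~~ s); split=> //.
  by rewrite xpair_eqE eqxx /=; case: s.
- move=> [x s] [y t] [z u] _ _ _; rewrite !conE /= => /eqP <- /eqP <-.
  by rewrite !xpair_eqE eqxx /=; case: s t u => -[] [].
move=> [x s] [y t] [z u] [w v] _ _ _ _; rewrite !conE /= => /eqP <- /eqP <-.
rewrite /circle_pos /=; have := ltn_ord x; have := ltn_ord z.
by case: s t u v => -[] [] [] /=; lia.
Qed.

End MidGraph.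

(** * The pairing as a count of cycles *)

Lemma pedge_uniq k p x y z : motzkin_path k p -> pedge p x y -> pedge p x z -> y = z.
Proof.
move=> mp.
have fw a b c : arch p a b -> arch p a c -> b = c.
  by move=> /(partnerP mp) e /(partnerP mp); rewrite e => -[].
have bw a b c : arch p b a -> arch p c a -> b = c.
  case=> ba pb gtb [ca pc gtc]; have := gtb c; have := gtc b.
  by case: (ltngtP b c) => // ?; lia.
have no a b c : arch p a b -> arch p c a -> False.
  by move=> /(arch_step mp)[pa _] /(arch_step mp)[_]; rewrite pa.
move=> /(pedgeP mp)[h1|h1] /(pedgeP mp)[h2|h2].
- exact: fw h1 h2.
- by case: (no _ _ _ h1 h2).
- by case: (no _ _ _ h2 h1).
- exact: bw h1 h2.
Qed.

Section Pairing.
Variables (k : nat) (p q : seq int).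
Hypotheses (mp : motzkin_path k p) (mq : motzkin_path k q).

(** The condition for the product diagram to be [d_q^p], read off the middle row alone. *)
Definition through : bool :=
  [forall u : 'I_k, forall v : 'I_k, white p u ==> (white q v ==>
    (connect (@mid k p q) u v == (wrank p u == wrank q v)))].

Lemma throughP : reflect (forall u v : 'I_k, white p u -> white q v ->
    connect (@mid k p q) u v = (wrank p u == wrank q v)) through.
Proof.
apply: (iffP forallP) => [h u v wu wv|h u].
  by have /forallP/(_ v) := h u; rewrite wu wv /= => /eqP.
by apply/forallP => v; apply/implyP => wu; apply/implyP => wv; rewrite h.
Qed.

Let S := stack_es (dpq k p p) (dpq k q q).
Let M : rel 'I_k := mid p q.
Let side (u : svtx k) := if u.1 == 0%N :> nat then p else q.
(* [u] lies on the same component as the middle vertex of its column *)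
Let att (u : svtx k) := (u.1 == 1%N :> nat) || white (side u) u.2.

Lemma stack_es_sym k' (d1 d2 : rel (vtx k')) : symmetric (stack_es d1 d2).
Proof. by move=> x y; rewrite /stack_es orbC. Qed.

Let T x y : bool := (att x && att y && connect M x.2 y.2) ||
  [&& ~~ att x, ~~ att y, x.1 == y.1 & pedge (side x) x.2 y.2].

Let msym : connect_sym M.
Proof. exact: connect_symC (@mid_symmetric k p q). Qed.

Let T_sym x y : T x y -> T y x.
Proof.
rewrite /T => /orP[/andP[/andP[-> ->]]|/and4P[ax ay /eqP xy e]]; first by rewrite msym => ->.
by rewrite ax ay xy eqxx pedge_sym /= /side -xy e !orbT.
Qed.

Let stack_e_T x y : stack_e (dpq k p p) (dpq k q q) x y -> T x y.
Proof.
have pp a b r : motzkin_path k r -> pedge r a b -> (white r a = false) * (white r b = false).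
  by move=> mr ab; split; apply/negP => w; move: ab; rewrite ?(white_no_pedge _ mr w) // pedge_sym (white_no_pedge _ mr w).
have cc (a b : 'I_k) r : [&& white r a, white r b & wrank r a == wrank r b] -> a = b /\ white r a.
  by case/and3P => wa wb /eqP /(wrank_inj wa wb) /val_inj ->.
have cn (a b : 'I_k) : pedge p a b || pedge q a b -> connect M a b by move=> h; apply: connect1.
move: x y => [[[|[|[|//]]] hx] a] [[[|[|[|//]]] hy] b]; rewrite /stack_e /T /att /side /= ?orbF ?andbF //.
- by move=> e; rewrite !(pp _ _ _ mp e) e.
- by move=> /cc[-> ->]; rewrite connect0.
- by move=> /cc[ab]; rewrite ab => ->; rewrite connect0.
- by move=> /cn ->.
- by move=> /cc[-> ->]; rewrite connect0.
- by move=> /cc[ab]; rewrite ab => ->; rewrite connect0.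
- by move=> e; rewrite !(pp _ _ _ mq e) e.
Qed.

Let S_T x y : S x y -> T x y.
Proof. by case/orP => /stack_e_T // /T_sym. Qed.

Let Rel u v := if att u && att v then connect M u.2 v.2 else
  [&& ~~ att u, ~~ att v, u.1 == v.1 & (u.2 == v.2) || pedge (side u) u.2 v.2].

Let mside u : motzkin_path k (side u).
Proof. by rewrite /side; case: ifP. Qed.

Let o1 : 'I_3 := inord 1.
Let o1E : o1 = 1%N :> nat. Proof. by rewrite inordK. Qed.

Let connect_att u : att u -> connect S (o1, u.2) u.
Proof.
move: u => [l a]; rewrite /att /side /= => h.
have [l1|l1] := eqVneq l o1; first by rewrite l1 connect0.
have {h} h : white (if l == 0%N :> nat then p else q) a.
  by case/orP: h => // /eqP le; case/eqP: l1; apply: val_inj; rewrite /= o1E.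
apply: connect1; rewrite /S /stack_es /stack_e /= o1E.
have := ltn_ord l; move: l1 h; rewrite -val_eqE /= o1E.
by case: l => [[|[|[|]]]] //= _ _ ->; rewrite eqxx ?orbT.
Qed.

Let ssym : connect_sym S.
Proof. exact: connect_symC (@stack_es_sym _ _ _). Qed.

(** A white vertex of the top or bottom row is joined straight to the middle vertex of its own
    column and so follows the middle row. Any other outer vertex is connected only to itself and to
    its partner in the same row, if it has one. *)
Lemma connect_stack u v : connect S u v = Rel u v.
Proof.
apply/idP/idP.
  apply: (@connect_ind _ _ (fun w => Rel u w)) => [x y /S_T|]; last first.
    by rewrite /Rel; case: (att u) => /=; rewrite ?connect0 ?eqxx.
  rewrite /T /Rel => /orP[/andP[/andP[ax ay] cxy]|/and4P[ax ay /eqP xy e]].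
    rewrite ax ay !andbT; case: (att u) => //=.
    by move=> cux; apply: connect_trans cux cxy.
  rewrite (negPf ax) (negPf ay) !andbF => /and4P[-> _ /eqP ux /orP[/eqP u2|e2]] /=.
    by rewrite ux xy eqxx u2 /side ux e orbT.
  rewrite ux xy eqxx /=; suff -> : u.2 = y.2 by rewrite eqxx.
  apply: val_inj; apply: (pedge_uniq (x := x.2) (mside x)) => //.
  by move: e2; rewrite pedge_sym /side ux.
rewrite /Rel; case: ifP => [/andP[au av] cuv|_].
  apply: connect_trans (connect_trans _ (connect_att av)).
    by rewrite ssym; apply: connect_att.
  apply: (@connect_ind _ _ (fun w => connect S (o1, u.2) (o1, w)) _ _ _ _ cuv); last exact: connect0.
  move=> x y exy h; apply: connect_trans h (connect1 _).
  by move: exy; rewrite /M /mid /S /stack_es /stack_e /= o1E /= => ->.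
case/and4P => au av /eqP uv /orP[/eqP u2|e].
  by rewrite [u]surjective_pairing [v]surjective_pairing uv u2 connect0.
apply: connect1; move: u v au av uv e => [l a] [m b] /=; rewrite /att /side /= => au _ <-.
rewrite /S /stack_es /stack_e /=; move: au; have := ltn_ord l.
by case: l => [[|[|[|]]]] //= _ _ _ ->.
Qed.

(** A closed loop never contains an outer vertex: such a vertex would hang on a middle vertex that
    is white in one of the factors and hence unmatched there. *)
Lemma nloopsE : nloops (dpq k p p) (dpq k q q) = mid_loops k p q.
Proof.
(* Components are counted by their roots on one side and as vertex sets on the other; [component] is
   injective on roots. *)
have -> : nloops (dpq k p p) (dpq k q q) = loops S (loopv (dpq k p p) (dpq k q q)).
  rewrite /nloops /loops -/S; set A := [set v | _].
  rewrite -(@card_in_imset _ _ (component S) A); last first.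
    move=> v w; rewrite !inE => /and3P[_ /eqP rv _] /and3P[_ /eqP rw _].
    by move/(component_inj ssym) => vw; rewrite -rv -rw; apply/eqP; rewrite root_connect.
  congr #|pred_of_set _|; apply/setP => C; apply/imsetP/imsetP => -[v].
    rewrite inE => /and3P[_ _ /forallP lv] ->; exists v => //; rewrite inE.
    by apply/subsetP => w; rewrite inE => vw; have := lv w; rewrite vw.
  rewrite inE => /subsetP lv ->.
  have vr : connect S v (fingraph.root S v) by apply: connect_root.
  exists (fingraph.root S v); last exact: component_eq.
  have lr w : connect S (fingraph.root S v) w -> loopv (dpq k p p) (dpq k q q) w.
    by move=> rw; apply: lv; rewrite inE; apply: connect_trans vr rw.
  rewrite inE (root_root ssym) eqxx; apply/and3P; split=> //.
    by have /and3P[] := lr _ (connect0 _ _).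
  by apply/forallP => w; apply/implyP/lr.
have gE x : loopv (dpq k p p) (dpq k q q) (o1, x) = cyclic_vertex (ends p q) x.
  by rewrite /loopv /middle /= o1E /cyclic_vertex /= /ends /= !negbK.
have connE x y : connect S (o1, x) (o1, y) = connect M x y.
  by rewrite connect_stack /Rel /att /= o1E.
apply: (@loops_transfer _ _ (fun x => (o1, x))) => // [x y []//|[l x] /and3P[/eqP l1 _ _]|x [l y] /subsetP xc].
  by exists x; congr (_, _); apply: val_inj; rewrite /= o1E.
rewrite connect_stack /Rel /att /= o1E /=; case: ifP => // aw xy.
have {xc} : y \in cyclic_vertex (@ends k p q) by apply: xc; rewrite inE.
rewrite inE /= /ends /= !negbK => /andP[/existsP[y1 e1] /existsP[y2 e2]].
case/orP: aw => [/eqP l1|w]; first by exists y; congr (_, _); apply: val_inj; rewrite /= o1E.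
by move: w; rewrite /side; case: ifP => _ w; [move: e1|move: e2];
  rewrite ?(white_no_pedge _ mp w) ?(white_no_pedge _ mq w).
Qed.

Hypothesis pq : psum p k = psum q k.

(** Equality of diagrams also restricts pairs within one row. With equally many whites in both paths
    this follows: two whites of p on one strand would both be joined to the white of q having the
    rank of the first, so their ranks agree. *)
Lemma diag_eq_through :
  diag_eq (dprod_rel (dpq k p p) (dpq k q q)) (dpq k q p) = through.
Proof.
have i0 : @inord 2 0 = 0%N :> nat by rewrite inordK.
have i2 : @inord 2 2 = 2%N :> nat by rewrite inordK.
have outE : forall u v : vtx k, (outv u != outv v) = (u != v).
  move=> [b a] [b' a']; congr (~~ _); rewrite /outv /= !xpair_eqE -[inord _ == inord _]val_eqE /=.
  by case: b b' => -[]; rewrite ?i0 ?i2.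
have rk : wrank p k = wrank q k by have := wrank_size mp; have := wrank_size mq; rewrite pq; lia.
apply/forallP/throughP => [h u v wu wv|h].
  have /forallP/(_ (false, v))/eqP := h (true, u).
  rewrite /dprod_rel outE connect_stack /Rel /att /side /= i0 i2 /= wu wv /=.
  by [].
have ww (a b : 'I_k) : white p a -> white p b -> connect M a b -> a = b.
  move=> wa wb ab; apply: val_inj; apply: (wrank_inj wa wb).
  have lt : (wrank p a < wrank q k)%N by rewrite -rk; exact: (wrank_ltn mp).
  have wc := white_wpos mq lt; have ec := wrank_wpos mq lt.
  have cc (z : 'I_k) : white p z -> connect M z (Ordinal (white_lt mq wc)) = (wrank p z == wrank p a).
    by move=> wz; rewrite h // ec.
  have := cc a wa; rewrite eqxx => ac; have := cc b wb; rewrite (connect_trans _ ac); last by rewrite msym.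
  by move/esym/eqP.
have ww' (a b : 'I_k) : white q a -> white q b -> connect M a b -> a = b.
  move=> wa wb ab; apply: val_inj; apply: (wrank_inj wa wb).
  have lt : (wrank q a < wrank p k)%N by rewrite rk; exact: (wrank_ltn mq).
  have wc := white_wpos mp lt; have ec := wrank_wpos mp lt.
  have cc (z : 'I_k) : white q z -> connect M (Ordinal (white_lt mp wc)) z = (wrank q a == wrank q z).
    by move=> wz; rewrite h // ec.
  have := cc a wa; rewrite eqxx => ac; have := cc b wb.
  by rewrite (connect_trans ac ab) => /esym/eqP.
have nw (a b : 'I_k) r : motzkin_path k r -> white r a || white r b -> pedge r a b = false.
  by move=> mr /orP[] w; [|rewrite pedge_sym]; apply: (white_no_pedge _ mr).
have irr (a : 'I_k) r : motzkin_path k r -> pedge r a a = false.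
  by move=> mr; apply/negP => /(pedgeP mr)[] [] ; rewrite ltnn.
move=> [[] a]; apply/forallP => -[[] b]; apply/eqP;
  rewrite /dprod_rel outE connect_stack /Rel /att /side /= ?i0 ?i2 /= ?xpair_eqE /=.
- have [->|ab] := eqVneq a b; first by rewrite irr.
  case wa: (white p a); case wb: (white p b) => /=; rewrite ?eqxx //=.
  + rewrite (nw _ _ p) ?wa //; apply/negP => /(ww _ _ wa wb) /eqP.
    by rewrite (negPf ab).
  + by rewrite (nw _ _ p) ?wa.
  + by rewrite (nw _ _ p) ?wb ?orbT.
- case wa: (white p a); case wb: (white q b) => //=; first exact: h.
  by rewrite -val_eqE /= i0 i2.
- case wa: (white q a); case wb: (white p b) => //=; first by rewrite msym h // eq_sym.
  by rewrite -val_eqE /= i0 i2.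
- have [->|ab] := eqVneq a b; first by rewrite irr.
  case wa: (white q a); case wb: (white q b) => /=; rewrite ?eqxx //=.
  + rewrite (nw _ _ q) ?wa //; apply/negP => /(ww' _ _ wa wb) /eqP.
    by rewrite (negPf ab).
  + by rewrite (nw _ _ q) ?wa.
  + by rewrite (nw _ _ q) ?wb ?orbT.
Qed.

Lemma pairingE : pairing k p q = if through then xK ^+ mid_loops k p q else 0.
Proof. by rewrite /pairing diag_eq_through nloopsE. Qed.

End Pairing.

(** * Planar diagrams from r to r + 2 points *)

(* The strands of a planar diagram from [r] points (numbered a) to [r.+2] points
   (numbered s): [PQ a s] for a through strand, [QQ s s'] for a strand joining two of
   the [r.+2] points.  The points [t] and [t.+1] are either capped off by an arc
   ([arc_through]: the result is the identity of [r] points) or both erased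
   ([dots_through]). *)
Section Strands.
Variables (r : nat) (PQ QQ : rel nat).
Hypothesis QQC : forall s s', (s < r.+2)%N -> (s' < r.+2)%N -> QQ s s' = QQ s' s.
Hypothesis PQ_inj : forall a a' s, (a < r)%N -> (a' < r)%N -> (s < r.+2)%N ->
  PQ a s -> PQ a' s -> a = a'.
Hypothesis PQ_fun : forall a s s', (a < r)%N -> (s < r.+2)%N -> (s' < r.+2)%N ->
  PQ a s -> PQ a s' -> s = s'.
Hypothesis PQ_QQ : forall a s s', (a < r)%N -> (s < r.+2)%N -> (s' < r.+2)%N ->
  PQ a s -> QQ s s' -> s = s'.
Hypothesis QQ_fun : forall s s1 s2, (s < r.+2)%N -> (s1 < r.+2)%N -> (s2 < r.+2)%N ->
  QQ s s1 -> QQ s s2 -> s != s1 -> s != s2 -> s1 = s2.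
Hypothesis PQ_planar : forall a s s1 s2, (a < r)%N -> (s1 < s < s2)%N -> (s2 < r.+2)%N ->
  PQ a s -> ~~ QQ s1 s2.

Definition dots_through t : bool :=
  [forall a : 'I_r, forall s : 'I_r, PQ a (skip2 t s) == (a == s)].
Definition arc_join t a s : bool :=
  [|| PQ a s, PQ a t && QQ t.+1 s | PQ a t.+1 && QQ t s].
Definition arc_through t : bool :=
  [forall a : 'I_r, forall s : 'I_r, arc_join t a (skip2 t s) == (a == s)].
(** Capping closes the arc into a cycle, whence an extra factor x; erasing its two points leaves the
    same strands without that factor. *)
Definition cup_at t : bool := QQ t t.+1 && dots_through t.

Let forall2P (Q : nat -> nat -> bool) :
  reflect (forall a s, (a < r)%N -> (s < r)%N -> Q a s = (a == s))
    [forall a : 'I_r, forall s : 'I_r, Q a s == (a == s)].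
Proof.
apply: (iffP forallP) => [h a s ar sr|h a].
  by have /forallP/(_ (Ordinal sr))/eqP := h (Ordinal ar).
by apply/forallP => s; rewrite h.
Qed.

Lemma dots_throughP t : reflect
  (forall a s, (a < r)%N -> (s < r)%N -> PQ a (skip2 t s) = (a == s)) (dots_through t).
Proof. exact: (forall2P (fun a s => PQ a (skip2 t s))). Qed.

Lemma arc_throughP t : reflect
  (forall a s, (a < r)%N -> (s < r)%N -> arc_join t a (skip2 t s) = (a == s)) (arc_through t).
Proof. exact: (forall2P (fun a s => arc_join t a (skip2 t s))). Qed.

Let skip_lt t s : (s < r)%N -> (skip2 t s < r.+2)%N.
Proof. by rewrite skip2E; lia. Qed.

Lemma dots_through_free t a : dots_through t -> (t <= r)%N -> (a < r)%N ->
  (PQ a t = false) * (PQ a t.+1 = false).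
Proof.
move=> /dots_throughP h tr ar; have := h a a ar ar; rewrite eqxx => ha.
have e := @PQ_fun a (skip2 t a) _ ar (skip_lt t ar) _ ha.
by split; apply/negP => /e; rewrite skip2E; lia.
Qed.

Lemma dots_arc_through t : (t <= r)%N -> dots_through t -> arc_through t.
Proof.
move=> tr dt; apply/arc_throughP => a s ar sr.
rewrite /arc_join !(dots_through_free dt tr ar) /= orbF; exact: (dots_throughP _ dt).
Qed.

(** The through strand at [t] continues over the cap to [t.+1] and along the arc to [t.+2]: the
    zigzag straightens to the identity and closes no cycle, whereas erasing [t] cuts the strand. *)
Lemma cup_atS t : (t < r)%N -> cup_at t.+1 ->
  [/\ arc_through t, ~~ QQ t t.+1 & ~~ dots_through t].
Proof.
move=> tr /andP[q /dots_throughP d].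
have ptt : PQ t t by have := d t t tr tr; rewrite skip2E eqxx ltnn muln0 addn0.
split.
- apply/arc_throughP => a s ar sr; rewrite /arc_join.
  have -> : PQ a t.+1 = false by apply/negP => pa; have := PQ_QQ ar _ _ pa q; lia.
  rewrite /= orbF; have [st|st] := eqVneq s t.
    rewrite st; have -> : skip2 t t = t.+2 by rewrite skip2E; lia.
    rewrite q andbT; have -> : PQ a t.+2 = false.
      by apply/negP => pa; rewrite QQC in q; [have := PQ_QQ ar _ _ pa q; lia|lia|lia].
    by have := d a t ar tr; rewrite skip2E ltnn muln0 addn0.
  have -> : QQ t.+1 (skip2 t s) = false.
    by apply/negP => q'; have := QQ_fun _ _ _ q q'; rewrite skip2E; lia.
  rewrite andbF orbF -(d a s ar sr); congr PQ; rewrite !skip2E; lia.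
- by apply/negP => q'; have := PQ_QQ tr _ _ ptt q'; lia.
- by apply/negP => dt; have := dots_through_free dt (ltnW tr) tr; rewrite ptt; case.
Qed.

(** The mirror image: the strand arriving at [t.+2] goes over the cap to [t.+1] and along the arc to
    [t]. *)
Lemma cup_at_pred t : (t < r)%N -> cup_at t ->
  [/\ arc_through t.+1, ~~ QQ t.+1 t.+2 & ~~ dots_through t.+1].
Proof.
move=> tr /andP[q /dots_throughP d].
have ptt : PQ t t.+2.
  by have := d t t tr tr; rewrite skip2E eqxx leqnn muln1 addn2.
have q1 : QQ t.+1 t by rewrite QQC //; lia.
split.
- apply/arc_throughP => a s ar sr; rewrite /arc_join.
  have -> : PQ a t.+1 = false by apply/negP => pa; have := PQ_QQ ar _ _ pa q1; lia.
  have [st|st] := eqVneq s t.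
    rewrite st; have -> : skip2 t.+1 t = t by rewrite skip2E; lia.
    rewrite q1 andbT; have -> : PQ a t = false.
      by apply/negP => pa; have := PQ_QQ ar _ _ pa q; lia.
    by have := d a t ar tr; rewrite skip2E leqnn muln1 addn2.
  have -> : QQ t.+1 (skip2 t.+1 s) = false.
    by apply/negP => q'; have := QQ_fun _ _ _ q1 q'; rewrite skip2E; lia.
  rewrite andbF /= orbF -(d a s ar sr); congr PQ; rewrite !skip2E; lia.
- by apply/negP => q'; rewrite QQC in q'; [have := PQ_QQ tr _ _ ptt q'; lia|lia|lia].
- by apply/negP => dt; have := dots_through_free dt tr tr; rewrite ptt; case.
Qed.

(** The two zigzags are the only ways in which the cap can be used: planarity keeps the arc from
    enclosing a through strand, so it is as short as possible. *)
Lemma arc_not_dots t : (t <= r)%N -> arc_through t -> ~~ dots_through t ->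
  ((t < r)%N && cup_at t.+1) || ((0 < t)%N && cup_at t.-1).
Proof.
move=> tr /arc_throughP h nd.
(* Some strand is not direct and therefore runs over the cap, entering at [t] or at [t.+1]. *)
have [a ar] : exists2 a, (a < r)%N & ~~ PQ a (skip2 t a).
  case: (pickP (fun a : 'I_r => ~~ PQ a (skip2 t a))) => [a pa|no]; first by exists a.
  case/negP: nd; apply/dots_throughP => a s ar sr.
  apply/idP/eqP => [pa|->]; last by have /= := no (Ordinal sr); case: PQ.
  by apply/eqP; rewrite -h // /arc_join pa.
move=> npa; have := h a a ar ar; rewrite eqxx /arc_join (negPf npa) /=.
case/orP => /andP[pa q].
- have := @PQ_planar a t (skip2 t a) t.+1 ar.
  rewrite QQC ?skip_lt // q => /(_ _ _ pa) npl.
  have ta : (t <= a)%N by move: npl; rewrite skip2E; lia.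
  have ea : skip2 t a = a.+2 by rewrite skip2E ta; lia.
  rewrite ea in q; have fr a' : (a' < r)%N -> PQ a' t.+1 = false.
    by move=> a'r; apply/negP => pa'; have := PQ_QQ a'r _ _ pa' q; lia.
  (* Otherwise the strand that becomes the [t]-th would have to end at [t.+2], which the arc from
     [t.+1] to [a.+2] encloses. *)
  have {ta} at' : a = t.
    apply/eqP; case: eqP => // nat; have tr' : (t < r)%N by lia.
    have := h t t tr' tr'; rewrite eqxx /arc_join fr //= orbF.
    have -> : skip2 t t = t.+2 by rewrite skip2E; lia.
    case/orP => [pt|/andP[_ q']]; last by have := QQ_fun _ _ _ q q'; lia.
    by have := @PQ_planar t t.+2 t.+1 a.+2 tr' _ _ pt; rewrite q => /(_ ltac:(lia) ltac:(lia)).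
  subst a; apply/orP; left; rewrite ar /cup_at q /=; apply/dots_throughP => a s ar' sr.
  have [->|st] := eqVneq s t.
    have -> : skip2 t.+1 t = t by rewrite skip2E; lia.
    by apply/idP/eqP => [pa'|->//]; apply: PQ_inj pa' pa => //; lia.
  rewrite -(h a s ar' sr) /arc_join fr //= orbF.
  have -> : QQ t.+1 (skip2 t s) = false.
    by apply/negP => q'; have := QQ_fun _ _ _ q q'; rewrite skip2E; lia.
  by rewrite andbF orbF; congr PQ; rewrite !skip2E; lia.
have ta : (a < t)%N.
  have := @PQ_planar a t.+1 t (skip2 t a) ar _ (skip_lt t ar) pa; rewrite q skip2E; lia.
have ea : skip2 t a = a by rewrite skip2E; lia.
rewrite ea in q; have fr a' : (a' < r)%N -> PQ a' t = false.
  by move=> a'r; apply/negP => pa'; have := PQ_QQ a'r _ _ pa' q; lia.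
have at' : a = t.-1.
  apply/eqP; case: eqP => // nat; have tr' : (t.-1 < r)%N by lia.
  have := h t.-1 t.-1 tr' tr'; rewrite eqxx /arc_join fr //=.
  have -> : skip2 t t.-1 = t.-1 by rewrite skip2E; lia.
  case/orP => [pt|/andP[p' _]]; last by have := PQ_inj ar tr' _ pa p'; lia.
  have := @PQ_planar t.-1 t.-1 a t tr' _ _ pt; rewrite QQC in q; [|lia|lia].
  by rewrite q => /(_ ltac:(lia) ltac:(lia)).
apply/orP; right; have t0 : (0 < t)%N by lia.
have et : t.-1.+1 = t by lia.
rewrite t0 /cup_at et QQC; [|lia|lia]; rewrite -at' q /=; apply/dots_throughP => a' s ar' sr.
have [->|st] := eqVneq s a.
  have -> : skip2 a a = t.+1 by rewrite skip2E; lia.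
  by apply/idP/eqP => [pa'|->//]; apply: PQ_inj pa' pa => //; lia.
rewrite -(h a' s ar' sr) /arc_join fr //=.
have -> : QQ t (skip2 t s) = false.
  by apply/negP => q'; have := QQ_fun _ _ _ q q'; rewrite skip2E; lia.
by rewrite andbF orbF; congr PQ; rewrite !skip2E; lia.
Qed.

Lemma cup_at_excl t : (t < r)%N -> cup_at t -> cup_at t.+1 = false.
Proof.
by move=> tr ct; apply/negP => /(cup_atS tr)[_ _]; case/andP: ct => _ ->.
Qed.

Section Values.
Variables (F : fieldType) (x : F) (n : nat) (u : nat -> F).
Hypotheses (u0 : u 0%N = 1) (u1 : u 1%N = x - 1).
Hypothesis uSS : forall m, u m.+2 = (x - 1) * u m.+1 - u m.
Hypothesis u_neq0 : forall m, u m != 0.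

Definition term_value t : F :=
  (if arc_through t then x ^+ (n + QQ t t.+1) else 0)
  - (if dots_through t then x ^+ n else 0).

(** The recursion of [brack_aux] after pairing with a fixed path; the lowest level has no correction
    term because [0] = 0. *)
Fixpoint bracket_value t : F :=
  if t is t'.+1 then term_value t - (u t' / u t) * bracket_value t' else term_value 0.

Lemma term_valueE t : (t <= r)%N -> term_value t = x ^+ n *
  (if cup_at t then x - 1 else
   if ((t < r)%N && cup_at t.+1) || ((0 < t)%N && cup_at t.-1) then 1 else 0).
Proof.
move=> tr; rewrite /term_value.
have nb : ((t < r)%N && cup_at t.+1) || ((0 < t)%N && cup_at t.-1) ->
    [/\ arc_through t, ~~ QQ t t.+1 & ~~ dots_through t].
  case/orP => /andP[t1 c]; first exact: cup_atS.
  by case: t t1 tr c => // t _ tr c; apply: cup_at_pred.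
case ct: (cup_at t).
  case/andP: ct => -> dt; rewrite (dots_arc_through tr dt) dt addn1 exprS; ring.
have [dt|dt] := boolP (dots_through t).
  rewrite (dots_arc_through tr dt); case: ifP => [/nb[_ _]|_]; first by rewrite dt.
  by move: ct; rewrite /cup_at dt andbT => ->; rewrite addn0 subrr mulr0.
rewrite subr0; have [at'|at'] := boolP (arc_through t).
  have c := arc_not_dots tr at' dt; have [_ /negPf-> _] := nb c.
  by rewrite c addn0 mulr1.
by case: ifP => [/nb[]|_]; [rewrite (negPf at') | rewrite mulr0].
Qed.

(** Let the arc be at c and drop x^n. The value is 1 at t = c - 1. At t = c it is (x - 1) -
    u_{c-1}/u_c = u_{c+1}/u_c by the recurrence, or u_1/u_0 if c = 0. At t = c + 1 it is 1 -
    (u_c/u_{c+1})(u_{c+1}/u_c) = 0, and it stays 0. So at t = r only an arc at r survives. *)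
Lemma bracket_valueE t : (t <= r)%N -> bracket_value t = x ^+ n *
  (if cup_at t then u t.+1 / u t else
   if (t < r)%N && cup_at t.+1 then 1 else 0).
Proof.
elim: t => [|t IH] tr; first by rewrite /= term_valueE // u0 u1 divr1 /= orbF.
rewrite [bracket_value _]/= term_valueE // IH ?(ltnW tr) //= tr /=.
have [c0|c0] := boolP (cup_at t).
  (* An arc at [t.+2] with the identity elsewhere puts a through strand on the point [t], which the
     arc at [t] already occupies. *)
  have c2 : (t.+1 < r)%N && cup_at t.+2 = false.
    apply/negP => /andP[t1 /andP[_ /dots_throughP d2]].
    have ptt := d2 t t tr tr; rewrite eqxx skip2E in ptt.
    have {}ptt : PQ t t by move: ptt; rewrite (_ : (t.+2 <= t)%N = false) ?addn0 //; lia.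
    by case/andP: c0 => q0 _; have := PQ_QQ tr _ _ ptt q0; lia.
  rewrite cup_at_excl // c2 /= mulr1 mulr0.
  by have h1 := u_neq0 t; have h2 := u_neq0 t.+1; field; rewrite h1 h2.
have [c1|c1] := boolP (cup_at t.+1).
  by rewrite uSS; have h1 := u_neq0 t.+1; field; rewrite h1.
by rewrite orbF; ring.
Qed.

End Values.
End Strands.

(** * Brackets *)

(** Connectivity of vertices given as plain numbers, so that values of [wpos] can be used directly;
    numbers outside the row are connected to nothing. *)
Definition connect_pos k (e : rel 'I_k) (i j : nat) : bool :=
  [exists u : 'I_k, exists v : 'I_k, [&& val u == i, val v == j & connect e u v]].

Lemma connect_posE k (e : rel 'I_k) (u v : 'I_k) : connect_pos e u v = connect e u v.
Proof.
apply/existsP/idP => [[u' /existsP[v' /and3P[/eqP/val_inj-> /eqP/val_inj-> //]]]|uv].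
by exists u; apply/existsP; exists v; rewrite !eqxx.
Qed.

Lemma wpos_ord k p s : motzkin_path k p -> (s < wrank p k)%N ->
  exists u : 'I_k, [/\ wpos p s = u, white p u & wrank p u = s].
Proof.
move=> mp sk; exists (Ordinal (wpos_lt mp sk)).
by split; rewrite ?(white_wpos mp) ?(wrank_wpos mp).
Qed.

Lemma through_wpos k r p q : motzkin_path k p -> motzkin_path k q ->
    wrank p k = r -> wrank q k = r ->
  through k p q = [forall a : 'I_r, forall s : 'I_r,
    connect_pos (@mid k p q) (wpos p a) (wpos q s) == (a == s)].
Proof.
move=> mp mq rp rq; apply/throughP/forallP => [h a|h u v wu wv].
  apply/forallP => s; have [|u [-> wu eu]] := @wpos_ord k p a mp; first by rewrite rp.
  have [|v [-> wv ev]] := @wpos_ord k q s mq; first by rewrite rq.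
  by rewrite connect_posE h // eu ev.
have au : (wrank p u < r)%N by rewrite -rp; apply: (wrank_ltn mp).
have sv : (wrank q v < r)%N by rewrite -rq; apply: (wrank_ltn mq).
have /forallP/(_ (Ordinal sv))/eqP := h (Ordinal au).
by rewrite /= (wposK mp) // (wposK mq) // connect_posE.
Qed.

Lemma whites_uniq k p q : motzkin_path k p -> motzkin_path k q ->
    forall A B C : 'I_k * bool,
    whites p q A -> whites p q B -> whites p q C ->
  connect (mid p q) A.1 B.1 -> connect (mid p q) A.1 C.1 -> B != A -> C != A -> B = C.
Proof.
move=> mp mq A B C; have ne := mid_noncrossing mp mq.
by move=> /(ne_sub ne) EA /(ne_sub ne) EB /(ne_sub ne) EC; apply: (ne_uniq ne).
Qed.

Section Strands_of_paths.
Variables (k r : nat) (p b : seq int).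
Hypotheses (mp : motzkin_path k p) (mb : motzkin_path k b).
Hypotheses (rp : wrank p k = r) (rb : wrank b k = r.+2).

(** The superposition seen through the ranks of its white vertices. The facts that follow are the
    hypotheses on abstract planar strands. *)
Definition strandPQ : rel nat :=
  fun a s => connect_pos (@mid k p b) (wpos p a) (wpos b s).
Definition strandQQ : rel nat :=
  fun s s' => connect_pos (@mid k p b) (wpos b s) (wpos b s').

Let ne := mid_noncrossing mp mb.
Let sym : connect_sym (@mid k p b) := connect_symC (ne_sym ne).

Let pord a : (a < r)%N -> exists u : 'I_k, [/\ wpos p a = u, white p u & wrank p u = a].
Proof. by move=> ar; apply: wpos_ord; rewrite ?rp. Qed.

Let bord s : (s < r.+2)%N -> exists u : 'I_k, [/\ wpos b s = u, white b u & wrank b u = s].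
Proof. by move=> ar; apply: wpos_ord; rewrite ?rb. Qed.

Let uniq := whites_uniq mp mb.

Lemma strandQQC s s' : (s < r.+2)%N -> (s' < r.+2)%N -> strandQQ s s' = strandQQ s' s.
Proof.
move=> /bord[u [eu _ _]] /bord[v [ev _ _]].
by rewrite /strandQQ eu ev !connect_posE sym.
Qed.

Lemma strandPQ_inj a a' s : (a < r)%N -> (a' < r)%N -> (s < r.+2)%N ->
  strandPQ a s -> strandPQ a' s -> a = a'.
Proof.
move=> /pord[u [eu wu iu]] /pord[u' [eu' wu' iu']] /bord[v [ev wv _]].
rewrite /strandPQ eu eu' ev !connect_posE ![connect _ _ v]sym => h h'.
rewrite -iu -iu'; have e := @uniq (v, false) (u, true) (u', true) wv wu wu' h h'.
by have [->] : (u, true) = (u', true) by apply: e; rewrite xpair_eqE andbF.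
Qed.

Lemma strandPQ_fun a s s' : (a < r)%N -> (s < r.+2)%N -> (s' < r.+2)%N ->
  strandPQ a s -> strandPQ a s' -> s = s'.
Proof.
move=> /pord[u [eu wu _]] /bord[v [ev wv iv]] /bord[v' [ev' wv' iv']].
rewrite /strandPQ eu ev ev' !connect_posE => h h'.
rewrite -iv -iv'; have e := @uniq (u, true) (v, false) (v', false) wu wv wv' h h'.
by have [->] : (v, false) = (v', false) by apply: e; rewrite xpair_eqE andbF.
Qed.

Lemma strandPQ_QQ a s s' : (a < r)%N -> (s < r.+2)%N -> (s' < r.+2)%N ->
  strandPQ a s -> strandQQ s s' -> s = s'.
Proof.
move=> /pord[u [eu wu _]] /bord[v [ev wv iv]] /bord[v' [ev' wv' iv']].
rewrite /strandPQ /strandQQ eu ev ev' !connect_posE [connect _ u v]sym => h h'.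
rewrite -iv -iv'; have [->//|vv] := eqVneq v' v.
by have := @uniq (v, false) (u, true) (v', false) wv wu wv' h h'; rewrite !xpair_eqE (negPf vv) andbF => /(_ isT isT).
Qed.

Lemma strandQQ_fun s s1 s2 : (s < r.+2)%N -> (s1 < r.+2)%N -> (s2 < r.+2)%N ->
  strandQQ s s1 -> strandQQ s s2 -> s != s1 -> s != s2 -> s1 = s2.
Proof.
move=> /bord[v [ev wv iv]] /bord[v1 [ev1 wv1 iv1]] /bord[v2 [ev2 wv2 iv2]].
rewrite /strandQQ ev ev1 ev2 !connect_posE -iv -iv1 -iv2 => h h' n1 n2.
have e := @uniq (v, false) (v1, false) (v2, false) wv wv1 wv2 h h'.
have [->//] : (v1, false) = (v2, false).
by apply: e; rewrite xpair_eqE andbT; [apply: contra n1 | apply: contra n2] => /eqP->.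
Qed.

Lemma strandPQ_planar a s s1 s2 : (a < r)%N -> (s1 < s < s2)%N -> (s2 < r.+2)%N ->
  strandPQ a s -> ~~ strandQQ s1 s2.
Proof.
move=> /pord[u [eu wu _]] /andP[l1 l2] l3.
have /bord[v [ev wv iv]] : (s < r.+2)%N by lia.
have /bord[v1 [ev1 wv1 iv1]] : (s1 < r.+2)%N by lia.
have /bord[v2 [ev2 wv2 iv2]] := l3.
rewrite /strandPQ /strandQQ eu ev ev1 ev2 !connect_posE [connect _ v1 _]sym => h; apply/negP => h'.
(* Ends of [b] sit at positions 2k - v, all beyond that of [u] and in reversed order; hence [v2]
   comes before [v] and [v1] after it. *)
have := ne_nc ne (A := (u, true)) (B := (v, false)) (C := (v2, false)) (D := (v1, false)) wu wv wv2 wv1 h h'.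
rewrite /circle_pos /=.
have lt (y z : 'I_k) : (wrank b y < wrank b z)%N -> (y < z)%N.
  by rewrite !ltnNge; apply: contra => /(leq_wrank b).
have := lt v1 v; have := lt v v2; rewrite iv iv1 iv2.
have := ltn_ord u; have := ltn_ord v1; have := ltn_ord v2; have := ltn_ord v.
lia.
Qed.

Section Term.
Variable t : nat.
Hypothesis tr : (t <= r)%N.

Let tb : (t.+1 < wrank b k)%N. Proof. by rewrite rb. Qed.
Let wt : wrank b (wpos b t) = t. Proof. by apply: (wrank_wpos mb); lia. Qed.
Let wt1 : wrank b (wpos b t.+1) = t.+1. Proof. exact: (wrank_wpos mb). Qed.
Let wht : white b (wpos b t). Proof. by apply: (white_wpos mb); lia. Qed.
Let wht1 : white b (wpos b t.+1). Proof. exact: (white_wpos mb). Qed.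
Let consec : wrank b (wpos b t.+1) = (wrank b (wpos b t)).+1.
Proof. by rewrite wt wt1. Qed.

(** The new edge joins strands as [arc_join] says, and it closes a cycle exactly when its endpoints
    already lie on one strand. *)
Lemma pairing_cup : pairing k p (cup b (wpos b t.+1)) =
  if arc_through r strandPQ strandQQ t
  then xK ^+ (mid_loops k p b + strandQQ t t.+1) else 0.
Proof.
have mc := motzkin_path_cup mb wht wht1 consec.
have wc := white_cup mb wht wht1 consec.
have rc : wrank (cup b (wpos b t.+1)) k = r.
  by have := wrank_skip_size mb tb wc; rewrite rb; lia.
have [u [eu wu _]] := @bord t ltac:(lia); have [v [ev wv _]] := @bord t.+1 ltac:(lia).
rewrite ev in mc wc rc *; have ac := consec; rewrite eu ev in ac.
rewrite (pairingE mp mc); last first.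
  by have := wrank_size mp; have := wrank_size mc; rewrite rc rp => <- <-.
rewrite (mid_loops_cupr mb wu wv ac ne) /strandQQ eu ev connect_posE.
congr (if _ then _ else _); rewrite (through_wpos mp mc rp rc).
apply: eq_forallb => a; apply: eq_forallb => s; congr (_ == _).
rewrite (wpos_skip mb mc tb _) ?rc ?ltn_ord //; last by move=> x; rewrite ev.
have [z [ez _ _]] := @bord (skip2 t s) ltac:(by rewrite skip2E; have := ltn_ord s; lia).
have [y [ey _ _]] := pord (ltn_ord a).
rewrite /arc_join /strandPQ /strandQQ eu ev ez ey !connect_posE.
by rewrite (eq_connect (mid_cupr p mb wu wv ac)) connect_add_edge.
Qed.

(** Blackening two whites changes neither the graph nor its cycles, only which strands have to
    match. *)
Lemma pairing_dots : pairing k p (pdot b (wpos b t) (wpos b t.+1)) =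
  if dots_through r strandPQ t then xK ^+ mid_loops k p b else 0.
Proof.
have mc := motzkin_path_dots mb wht wht1 consec.
have wc := white_dots mb wht wht1 consec.
have rc : wrank (pdot b (wpos b t) (wpos b t.+1)) k = r.
  by have := wrank_skip_size mb tb wc; rewrite rb; lia.
have [u [eu wu _]] := @bord t ltac:(lia); have [v [ev wv _]] := @bord t.+1 ltac:(lia).
rewrite ev eu in mc wc rc *; have ac := consec; rewrite eu ev in ac.
rewrite (pairingE mp mc); last first.
  by have := wrank_size mp; have := wrank_size mc; rewrite rc rp => <- <-.
rewrite (mid_loops_dotsr p mb wu wv ac).
congr (if _ then _ else _); rewrite (through_wpos mp mc rp rc).
apply: eq_forallb => a; apply: eq_forallb => s; congr (_ == _).
rewrite (wpos_skip mb mc tb _) ?rc ?ltn_ord //; last by move=> x; rewrite ev eu.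
have [z [ez _ _]] := @bord (skip2 t s) ltac:(by rewrite skip2E; have := ltn_ord s; lia).
have [y [ey _ _]] := pord (ltn_ord a).
rewrite /strandPQ ez ey !connect_posE.
by rewrite (eq_connect (mid_dotsr p mb wu wv ac)).
Qed.

End Term.
End Strands_of_paths.

Lemma lastwhite_eq p m i : white p m -> (m < i)%N ->
  (forall x, (m < x < i)%N -> ~~ white p x) -> lastwhite p i = m.
Proof.
move=> wm mi no; rewrite /lastwhite.
have -> : iota 0 i = iota 0 m ++ m :: iota m.+1 (i - m.+1).
  have -> : i = (m + (i - m.+1).+1)%N by lia.
  by rewrite iotaD /= add0n; do 3!f_equal; lia.
rewrite filter_cat last_cat /= wm /=; case E: [seq _ <- _ | _] => [//|x s].
have : x \in [seq t <- iota m.+1 (i - m.+1) | white p t] by rewrite E mem_head.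
by rewrite mem_filter mem_iota => /andP[wx ix]; case/negP: (no x ltac:(lia)).
Qed.

Section BracketAux.
Variables (k : nat) (b : seq int).
Hypothesis mb : motzkin_path k b.

(** This is B_t; the fuel is [t] because the pivot edge has exactly [t] whites to its left. *)
Definition brack_cup t : seq int -> K :=
  brack_aux t (cup b (wpos b t.+1)) (wpos b t) (wpos b t.+1).

Lemma pdot_cup a c : pdot (cup b c) a c = pdot b a c.
Proof.
rewrite /pdot /cup; apply: (@eq_from_nth _ 0) => [|n _]; first by rewrite !size_set_nth; lia.
by do 3!rewrite !nth_set_nth /=; case: eqP => // _; case: eqP.
Qed.

(** Passing to p^{(1)} reopens [c] and closes at [a]: [b] stays the same and the cup moves one white
    vertex to the left. *)
Lemma pone_cup a c : (a < c < k)%N -> b`_c = 1 -> pone (cup b c) a c = cup b a.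
Proof.
move=> ac bc; rewrite /pone /cup; apply: (@eq_from_nth _ 0) => [|n _].
  by rewrite !size_set_nth (mp_size mb); lia.
do 3!rewrite ?nth_set_nth /=; case: eqP => [->|nc]; last by case: eqP.
by rewrite bc; case: eqP => //; lia.
Qed.

Lemma wposS_lt t : (t.+1 < wrank b k)%N -> (wpos b t < wpos b t.+1 < k)%N.
Proof.
by move=> tb; rewrite (wpos_lt mb tb) andbT; apply: (wpos_ltS mb tb).
Qed.

Lemma brack_cup0 q :
  brack_cup 0 q = pvec (cup b (wpos b 1)) q - pvec (pdot b (wpos b 0) (wpos b 1)) q.
Proof. by rewrite /brack_cup /= pdot_cup. Qed.

Lemma brack_cupS t q : (t.+2 < wrank b k)%N -> brack_cup t.+1 q =
  pvec (cup b (wpos b t.+2)) q - pvec (pdot b (wpos b t.+1) (wpos b t.+2)) q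
  - (uK t / uK t.+1) * brack_cup t q.
Proof.
move=> tb; have tb' : (t.+1 < wrank b k)%N by lia.
rewrite /brack_cup [brack_aux t.+1 _ _ _]/= pdot_cup pone_cup; last first.
- exact: white_step mb (white_wpos mb tb).
- exact: wposS_lt.
have w1 := white_wpos mb tb'; have w2 := white_wpos mb tb.
have i1 := wrank_wpos mb tb'; have i2 := wrank_wpos mb tb.
have w0 : white b (wpos b t) by apply: (white_wpos mb); lia.
have i0 : wrank b (wpos b t) = t by apply: (wrank_wpos mb); lia.
have cs : wrank b (wpos b t.+2) = (wrank b (wpos b t.+1)).+1 by rewrite i1 i2.
have l1 := wposS_lt tb'; have l2 := wposS_lt tb.
congr (_ - _ * _).
have -> // : lastwhite (cup b (wpos b t.+2)) (wpos b t.+1) = wpos b t.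
apply: lastwhite_eq => [||x xm]; rewrite ?(white_cup mb w1 w2 cs); [|lia|].
  by rewrite w0 /=; lia.
apply/negP => /and3P[wx _ _].
have h1 := ltn_wrank w0 (_ : wpos b t < x)%N; have h2 := ltn_wrank wx (_ : x < wpos b t.+1)%N.
by have := h1 ltac:(lia); have := h2 ltac:(lia); rewrite i0 i1; lia.
Qed.

End BracketAux.

(** * Paths with a flat or rising last step *)

Lemma size_cheb (m : nat) : size (cheb ('X - 1 : {poly rat}) m) = m.+1.
Proof.
have s1 : size ('X - 1 : {poly rat}) = 2 by rewrite -polyC1 size_XsubC.
elim/ltn_ind: m => -[|[|m]] IH; [by rewrite size_poly1 | exact: s1 |].
have -> : cheb ('X - 1 : {poly rat}) m.+2 =
  ('X - 1) * cheb ('X - 1) m.+1 - cheb ('X - 1) m by [].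
have sM : size (('X - 1 : {poly rat}) * cheb ('X - 1) m.+1) = m.+3.
  by rewrite size_mul -?size_poly_eq0 ?s1 ?IH.
by rewrite size_polyDl sM // size_polyN IH.
Qed.

Lemma uK_tofrac (m : nat) : uK m = FracField.tofrac (cheb ('X - 1 : {poly rat}) m).
Proof.
rewrite /uK /xK; elim/ltn_ind: m => -[|[|m]] IH; [by rewrite rmorph1 | by rewrite /= rmorphB rmorph1 |].
have E (R : pzRingType) (y : R) : cheb y m.+2 = y * cheb y m.+1 - cheb y m by [].
by rewrite !E !IH // rmorphB rmorphM rmorphB rmorph1.
Qed.

(** As a polynomial in x, u_m(x - 1) has degree m. This makes the quotients in the brackets genuine
    and lets them cancel. *)
Lemma uK_neq0 (m : nat) : uK m != 0.
Proof. by rewrite uK_tofrac tofrac_eq0 -size_poly_eq0 size_cheb. Qed.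

Lemma uK0 : uK 0 = 1. Proof. by []. Qed.
Lemma uK1 : uK 1 = xK - 1. Proof. by []. Qed.
Lemma uKSS (m : nat) : uK m.+2 = (xK - 1) * uK m.+1 - uK m. Proof. by []. Qed.

Lemma throughC k p q : through k p q = through k q p.
Proof.
apply/throughP/throughP => h u v wu wv.
  by rewrite (eq_connect (midC q p)) (connect_symC (@mid_symmetric k p q)) h // eq_sym.
by rewrite (eq_connect (midC p q)) (connect_symC (@mid_symmetric k q p)) h // eq_sym.
Qed.

Lemma pairingC k p q : motzkin_path k p -> motzkin_path k q -> psum p k = psum q k ->
  pairing k p q = pairing k q p.
Proof.
move=> mp mq pq; rewrite (pairingE mp mq pq) (pairingE mq mp) //.
by rewrite throughC mid_loopsC.
Qed.

(** * Deleting the last step *)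

Section Prime.
Variable k : nat.

Lemma last_nth_motzkin p : motzkin_path k.+1 p -> last 0 p = p`_k.
Proof. by move=> mp; rewrite -nth_last (mp_size mp). Qed.

Lemma pprimeK p : motzkin_path k.+1 p -> rcons (pprime p) (last 0 p) = p.
Proof.
move=> mp; rewrite /pprime (mp_size mp) /= (last_nth_motzkin mp) -take_nth ?(mp_size mp) //.
by rewrite take_oversize // (mp_size mp).
Qed.

Lemma psum_take p n m : psum (take n p) m = psum p (minn m n).
Proof.
elim: m => [|m IH]; first by rewrite min0n !psum0.
rewrite psumS IH; have [mn|mn] := ltnP m n.
  by rewrite nth_take // !(minn_idPl _) ?psumS // ltnW.
rewrite nth_default ?addr0; last by apply: leq_trans mn; rewrite size_take_min geq_minl.
by congr psum; lia.
Qed.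

Lemma motzkin_path_pprime p : motzkin_path k.+1 p -> motzkin_path k (pprime p).
Proof.
move=> mp; rewrite /pprime (mp_size mp) /=; split.
- by rewrite size_takel // (mp_size mp).
- move=> n; have [nk|nk] := ltnP n k; first by rewrite nth_take //; apply: (mp_step mp).
  by rewrite nth_default // size_take_min (leq_trans _ nk) // geq_minl.
- by move=> n; rewrite psum_take; apply: (mp_ge0 mp).
Qed.

Lemma psum_pprime p n : motzkin_path k.+1 p -> (n <= k)%N -> psum (pprime p) n = psum p n.
Proof.
by move=> mp nk; rewrite /pprime (mp_size mp) psum_take; congr psum; apply/minn_idPl.
Qed.

Lemma motzkin_path_rcons p a : motzkin_path k p -> -1 <= a <= 1 -> 0 <= psum p k + a ->
  motzkin_path k.+1 (rcons p a) /\ psum (rcons p a) k.+1 = psum p k + a.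
Proof.
move=> mp a1 pa.
have tk : take k (rcons p a) = p by rewrite -cats1 take_size_cat // (mp_size mp).
have ps n : (n <= k)%N -> psum (rcons p a) n = psum p n.
  by move=> nk; rewrite -[in RHS]tk psum_take; congr psum; apply/esym/minn_idPl.
have pk : psum (rcons p a) k.+1 = psum p k + a.
  by rewrite psumS ps // nth_rcons (mp_size mp) ltnn eqxx.
split=> //; split.
- by rewrite size_rcons (mp_size mp).
- move=> n; rewrite nth_rcons (mp_size mp); case: ltngtP => // _; exact: (mp_step mp).
- move=> n; have [nk|nk] := leqP n k; first by rewrite ps //; apply: (mp_ge0 mp).
  by rewrite psum_oversize ?size_rcons ?(mp_size mp) // pk.
Qed.

(** The inverse appends [a]; the lengthened path has final height [r], which is nonnegative by
    hypothesis. *)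
Lemma perm_pprime (r : int) a : -1 <= a <= 1 -> 0 <= r ->
  perm_eq [seq pprime p | p <- motzkin k.+1 r & last 0 p == a] (motzkin k (r - a)).
Proof.
move=> a1 r0; apply: uniq_perm; rewrite ?motzkin_uniq //.
  have uf := filter_uniq (fun p => last 0 p == a) (motzkin_uniq k.+1 r).
  rewrite map_inj_in_uniq // => p q.
  rewrite mem_filter => /andP[/eqP lp /motzkinP[mp _]].
  rewrite mem_filter => /andP[/eqP lq /motzkinP[mq _]] e.
  by rewrite -(pprimeK mp) -(pprimeK mq) e lp lq.
move=> p; apply/mapP/motzkinP => [[q]|[mp pr]].
  rewrite mem_filter => /andP[/eqP lq /motzkinP[mq qr]] ->.
  split; first exact: motzkin_path_pprime.
  by rewrite psum_pprime // -qr psumS -(last_nth_motzkin mq) lq addrK.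
have [mr prr] := @motzkin_path_rcons p a mp a1 ltac:(by rewrite pr subrK).
exists (rcons p a).
  rewrite mem_filter last_rcons eqxx; apply/motzkinP; split=> //.
  by rewrite prr pr subrK.
by rewrite /pprime size_rcons -cats1 take_size_cat.
Qed.

Section Flat.
Variable p : seq int.
Hypotheses (mp : motzkin_path k.+1 p) (pk : p`_k != -1).

Let mp' : motzkin_path k (pprime p) := motzkin_path_pprime mp.

(** A last step other than -1 closes no edge, so deleting the last vertex loses none. *)
Lemma arch_pprime x y : arch (pprime p) x y <-> arch p x y.
Proof.
split=> h.
  have yk := arch_lt mp' h; case: h => xy e gt; split=> //.
    by move: e; rewrite !(psum_pprime mp) //; lia.
  by move=> n xn; have := gt n xn; rewrite !psum_pprime //; lia.
have yk : (y < k)%N.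
  have := arch_lt mp h; rewrite ltnS leq_eqVlt => /orP[/eqP yk|//].
  by have [_] := arch_step mp h; rewrite yk => /eqP; rewrite (negPf pk).
case: h => xy e gt; split=> //; first by rewrite !psum_pprime //; lia.
by move=> n xn; have := gt n xn; rewrite !psum_pprime //; lia.
Qed.

Lemma pedge_pprime x y : pedge (pprime p) x y = pedge p x y.
Proof.
by apply/(pedgeP mp')/(pedgeP mp) => -[] /arch_pprime; [left|right|left|right].
Qed.

Lemma pedge_last x : pedge p k x = false.
Proof.
rewrite -pedge_pprime; apply/negP => /(pedgeP mp')[h|/(arch_lt mp')]; last by rewrite ltnn.
by have := arch_lt mp' h; case: h; lia.
Qed.

Lemma white_pprime x : (x < k)%N -> white (pprime p) x = white p x.
Proof.
move=> xk; apply/idP/idP => [/(whiteP mp')|/(whiteP mp)] [_ gt].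
  apply/(whiteP mp); split=> [|n xn]; first by lia.
  have [nk|nk] := leqP n k; first by have := gt n; rewrite !psum_pprime //; lia.
  have -> : n = k.+1 by lia.
  have := gt k; rewrite !psum_pprime //; last by lia.
  have := mp_step mp k; rewrite psumS; move: pk; lia.
apply/(whiteP mp'); split=> // n xn; have := gt n; rewrite !psum_pprime //; lia.
Qed.

Lemma wrank_pprime x : (x <= k)%N -> wrank (pprime p) x = wrank p x.
Proof.
elim: x => // x IH xk; rewrite !wrankS IH ?(ltnW xk) // white_pprime //.
Qed.

End Flat.

Lemma val_lift_max (x : 'I_k) : lift ord_max x = x :> nat.
Proof. by rewrite /= /bump leqNgt ltn_ord. Qed.

Lemma mid_isolated n p q (z : 'I_n) : (forall y : 'I_n, mid p q z y = false) ->
  forall y : 'I_n, connect (mid p q) z y = (z == y).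
Proof.
move=> iso y; apply/idP/eqP => [|->//]; apply: (@connect_ind _ _ (fun w => z = w)) => //.
by move=> u v uv zu; move: uv; rewrite -zu iso.
Qed.

Section Flat2.
Variables p q : seq int.
Hypotheses (mp : motzkin_path k.+1 p) (mq : motzkin_path k.+1 q).
Hypotheses (pk : p`_k != -1) (qk : q`_k != -1).

Lemma connect_last y : connect (@mid k.+1 p q) ord_max y = (ord_max == y).
Proof. by apply: mid_isolated => {}y; rewrite /mid /= !pedge_last. Qed.

Lemma connect_pprime (x y : 'I_k) :
  connect (@mid k.+1 p q) (lift ord_max x) (lift ord_max y) =
  connect (@mid k (pprime p) (pprime q)) x y.
Proof.
have symk := connect_symC (@mid_symmetric k.+1 p q).
apply/idP/idP; last first.
  apply: (@connect_ind _ _ (fun w => connect (@mid k.+1 p q) (lift ord_max x) (lift ord_max w))) => [u v uv h|//].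
  apply: connect_trans h (connect1 _).
  by move: uv; rewrite /mid !val_lift_max !pedge_pprime.
move=> h; suff : exists2 z, lift ord_max y = lift ord_max z & connect (@mid k (pprime p) (pprime q)) x z.
  by case=> z /lift_inj ->.
apply: (@connect_ind _ _ (fun w => exists2 z, w = lift ord_max z & connect (@mid k (pprime p) (pprime q)) x z) _ _ _ _ h); last by exists x.
move=> u v uv [z uz xz]; subst u; case: (unliftP ord_max v) => [w vw|vmax].
  exists w => //; apply: connect_trans xz (connect1 _).
  by move: uv; rewrite vw /mid !val_lift_max !pedge_pprime.
by move: uv; rewrite vmax mid_symmetric /mid /= !pedge_last.
Qed.

Hypothesis pq : psum p k.+1 = psum q k.+1.
Hypothesis pqk : p`_k = q`_k.

Let psumk : psum p k = psum q k.
Proof. by move: pq; rewrite !psumS pqk => /addIr. Qed.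

Let rkk : wrank p k = wrank q k.
Proof.
have := wrank_size (motzkin_path_pprime mp); have := wrank_size (motzkin_path_pprime mq).
by rewrite !psum_pprime // !wrank_pprime // psumk => <- [].
Qed.

(** The last vertex is isolated in the superposition. If it is white, it is so in both factors and
    has the largest rank in each, so it matches only itself. *)
Lemma through_pprime : through k.+1 p q = through k (pprime p) (pprime q).
Proof.
have symk := connect_symC (@mid_symmetric k.+1 p q).
apply/throughP/throughP => [h u v wu wv|h u v].
  move: wu wv; rewrite (white_pprime mp pk) // (white_pprime mq qk) // => wu wv.
  rewrite -connect_pprime h ?val_lift_max //.
  by rewrite (wrank_pprime mp pk) ?(wrank_pprime mq qk) // ltnW.
case: (unliftP ord_max u) => [x ->|->]; case: (unliftP ord_max v) => [y ->|->].
- rewrite connect_pprime !val_lift_max => wx wy.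
  by rewrite h ?white_pprime // !wrank_pprime // ltnW.
- rewrite symk connect_last val_lift_max => wx _; rewrite (negPf (neq_lift _ _)) /=.
  have := ltn_wrank wx (ltn_ord x); have := ltn_ord x; rewrite -rkk.
  by move=> /= h1 h2; apply/esym/eqP; lia.
- rewrite connect_last val_lift_max => _ wy; rewrite (negPf (neq_lift _ _)) /=.
  have := ltn_wrank wy (ltn_ord y); have := ltn_ord y; rewrite rkk.
  by move=> /= h1 h2; apply/esym/eqP; lia.
- by rewrite connect0 /= rkk eqxx.
Qed.

Lemma mid_loops_pprime : mid_loops k.+1 p q = mid_loops k (pprime p) (pprime q).
Proof.
have ex (s : seq int) (x : 'I_k) : motzkin_path k.+1 s -> s`_k != -1 ->
    [exists y : 'I_k.+1, pedge s (lift ord_max x) y] = [exists y : 'I_k, pedge (pprime s) x y].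
  move=> ms sk; apply/existsP/existsP => -[y]; last first.
    by rewrite pedge_pprime // => xy; exists (lift ord_max y); rewrite !val_lift_max.
  case: (unliftP ord_max y) => [z ->|->]; last by rewrite pedge_sym /= pedge_last.
  by rewrite !val_lift_max => xz; exists z; rewrite pedge_pprime.
apply: (@loops_transfer _ _ (lift ord_max)).
- exact: lift_inj.
- exact: connect_pprime.
- by move=> x; rewrite /cyclic_vertex /= /ends /= !ex.
- move=> v; case: (unliftP ord_max v) => [x -> _|->]; first by exists x.
  rewrite /cyclic_vertex /= /ends /= !negbK => /andP[/existsP[y]].
  by rewrite pedge_last.
- move=> x w _; case: (unliftP ord_max w) => [y -> _|->]; first by exists y.
  rewrite (connect_symC (@mid_symmetric k.+1 p q)) connect_last => /eqP e.
  by have := neq_lift ord_max x; rewrite -e eqxx.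
Qed.

Lemma pairing_pprime : pairing k.+1 p q = pairing k (pprime p) (pprime q).
Proof.
rewrite (pairingE mp mq pq) through_pprime mid_loops_pprime pairingE //.
- exact: motzkin_path_pprime.
- exact: motzkin_path_pprime.
- by rewrite !psum_pprime.
Qed.

End Flat2.
End Prime.

(** * Pairing with a bracket *)

Definition pair_with k (r : int) (p : seq int) (w : seq int -> K) : K :=
  \sum_(q <- motzkin k r) w q * pairing k p q.

Lemma sum_pvec (R : nmodType) (s : seq (seq int)) (p : seq int) (f : seq int -> R) :
  uniq s -> p \in s -> \sum_(q <- s | q == p) f q = f p.
Proof.
by move=> us ps; rewrite big_mkcond (bigD1_seq p) //= eqxx big1 ?addr0 // => q /negPf ->.
Qed.

Lemma pair_with_pvec k r p q : q \in motzkin k r -> pair_with k r p (pvec q) = pairing k p q.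
Proof.
move=> qM; rewrite -(sum_pvec (pairing k p) (motzkin_uniq k r) qM) big_mkcond.
by apply: eq_bigr => q' _; rewrite /pvec; case: eqP => _; rewrite ?mul1r ?mul0r.
Qed.

Lemma gform_pvec k r p w : p \in motzkin k r -> gform k r (pvec p) w = pair_with k r p w.
Proof.
move=> pM; rewrite -(sum_pvec (fun p => pair_with k r p w) (motzkin_uniq k r) pM) big_mkcond.
apply: eq_bigr => p' _; rewrite /pvec; case: eqP => _; last first.
  by rewrite big1 // => q _; rewrite !mul0r.
by apply: eq_bigr => q _; rewrite mul1r.
Qed.

Lemma gformE k r v w : gform k r v w = \sum_(p <- motzkin k r) v p * pair_with k r p w.
Proof.
apply: eq_bigr => p _; rewrite /pair_with big_distrr /=.
by apply: eq_bigr => q _; rewrite mulrA.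
Qed.

Lemma gformC k r v w : gform k r v w = gform k r w v.
Proof.
rewrite /gform exchange_big /= big_seq [RHS]big_seq; apply: eq_bigr => p /motzkinP[mp pr].
rewrite big_seq [RHS]big_seq; apply: eq_bigr => q /motzkinP[mq qr].
by rewrite (mulrC (v q)) (pairingC mq mp) // pr qr.
Qed.

Section Main.
Variables m r : nat.
Local Notation k := m.+1.
Local Notation M := (motzkin k r%:Z).

Lemma motzkin_wrank p : p \in M -> wrank p k = r.
Proof. by case/motzkinP => mp pr; have := wrank_size mp; rewrite pr => -[]. Qed.

Lemma motzkin_last p : p \in M -> last 0 p = p`_m.
Proof. by case/motzkinP => mp _; rewrite (last_nth_motzkin mp). Qed.

Lemma motzkin_last_cases p : p \in M -> [\/ last 0 p = 1, last 0 p = 0 | last 0 p = -1].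
Proof.
move=> pM; rewrite (motzkin_last pM); have /motzkinP[mp _] := pM; have := mp_step mp m.
have [->|n1] := eqVneq p`_m 1; first by constructor 1.
have [->|n0] := eqVneq p`_m 0; first by constructor 2.
by move=> ?; constructor 3; lia.
Qed.

Lemma pplusP q : q \in M -> last 0 q = -1 ->
  [/\ motzkin_path k (pplus q), wrank (pplus q) k = r.+2,
      wpos (pplus q) r.+1 = m, cup (pplus q) (wpos (pplus q) r.+1) = q &
      bracket q = brack_cup (pplus q) r].
Proof.
move=> qM; rewrite (motzkin_last qM) => qK; have /motzkinP[mq qr] := qM.
have rq := motzkin_wrank qM.
have after n : (m < n)%N -> q`_n != -1 by move=> ?; rewrite nth_default // (mp_size mq).
have [a [mb wa wc ac [ecup aq]]] := uncup mq (ltnSn m) qK after.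
have szq := mp_size mq.
have eK : (size q).-1 = m by rewrite szq.
(* [pivl] searches for an opening vertex of the edge ending at the last vertex; uniqueness of
   partners makes it the one found by [uncup]. *)
have piv : pivl q = a.
  have pa : partner q a == Some m by apply/eqP/(partnerP mq).
  have hasP : has (fun t => partner q t == Some (size q).-1) (iota 0 (size q)).
    apply/hasP; exists a; last by rewrite eK.
    by rewrite mem_iota szq; case: aq => am _ _; lia.
  have := nth_find 0%N hasP; rewrite /= nth_iota; last by rewrite -[X in (_ < X)%N](size_iota 0) -has_find.
  rewrite add0n eK -/(pivl q) => /eqP/(partnerP mq) ap.
  apply: (pedge_uniq (x := m) mq); apply/(pedgeP mq); right=> //.
  by rewrite /pivl eK.
have [qa _] := arch_step mq aq.
have eb : pplus q = set_nth 0 q m 1.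
  rewrite /pplus piv eK; apply: (@eq_from_nth _ 0) => [|n _].
    by rewrite !size_set_nth; case: aq => am _ _; lia.
  by do 2!rewrite ?nth_set_nth /=; case: eqP => // _; case: eqP => // ->.
rewrite eb; set b := set_nth 0 q m 1 in mb wa wc ac ecup eb *.
have rb : wrank b k = r.+2.
  have := wrank_size mb; rewrite psum_set_nth qK qr ltnSn => h.
  by apply/eqP; rewrite -eqz_nat h; apply/eqP; lia.
have rc : wrank b m = r.+1 by move: rb; rewrite wrankS wc addn1 => -[].
have ra : wrank b a = r by move: ac; rewrite rc => -[].
have ewc : wpos b r.+1 = m by rewrite -rc (wposK mb wc).
have ewa : wpos b r = a by rewrite -ra (wposK mb wa).
split=> //; first by rewrite ewc.
rewrite /bracket /brack piv eK /brack_cup ewc ewa ecup; congr brack_aux.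
(* It remains to check the fuel. Joining takes away the whites [a] and [m], neither of which lies
   left of [a], so [q] has [r] whites there, as [b] does. *)
have tb : (r.+1 < wrank b k)%N by rewrite rb.
have := @wrank_skip k b q r mb tb _ a; rewrite ewa ewc ltnn ra.
move=> <-; first by have := cup_lt mb wa wc ac; lia.
by move=> x; rewrite -[in LHS]ecup (white_cup mb wa wc ac).
Qed.

Section CupTerms.
Variables (b : seq int) (t : nat).
Hypotheses (mb : motzkin_path k b) (rb : wrank b k = r.+2) (tr : (t <= r)%N).

Lemma cup_dots_motzkin : (cup b (wpos b t.+1) \in M) /\ (pdot b (wpos b t) (wpos b t.+1) \in M).
Proof.
have tb : (t.+1 < wrank b k)%N by rewrite rb.
have w0 : white b (wpos b t) by apply: (white_wpos mb); lia.
have w1 : white b (wpos b t.+1) := white_wpos mb tb.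
have ac : wrank b (wpos b t.+1) = (wrank b (wpos b t)).+1.
  by rewrite !(wrank_wpos mb) //; lia.
have lt := cup_lt mb w0 w1 ac.
have hb : psum b k = r%:Z + 2 by rewrite -(wrank_size mb) rb; lia.
split; apply/motzkinP; split.
- exact: motzkin_path_cup ac.
- by have := psum_cup mb w0 w1 ac k; lia.
- exact: motzkin_path_dots ac.
- by have := psum_dots mb w0 w1 ac k; lia.
Qed.

End CupTerms.

Lemma pair_with_brack_cup p b t : p \in M -> motzkin_path k b -> wrank b k = r.+2 ->
  (t <= r)%N -> pair_with k r p (brack_cup b t) =
  bracket_value r (strandPQ k p b) (strandQQ k p b) xK (mid_loops k p b) uK t.
Proof.
move=> pM mb rb; have /motzkinP[mp _] := pM; have rp := motzkin_wrank pM.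
have base s : (s <= r)%N ->
    pairing k p (cup b (wpos b s.+1)) - pairing k p (pdot b (wpos b s) (wpos b s.+1)) =
    term_value r (strandPQ k p b) (strandQQ k p b) xK (mid_loops k p b) s.
  by move=> sr; rewrite (pairing_cup mp mb rp rb sr) (pairing_dots mp mb rp rb sr).
elim: t => [|t IH] tr.
  have [cM dM] := cup_dots_motzkin mb rb tr.
  rewrite /= -base // -(pair_with_pvec p cM) -(pair_with_pvec p dM) -sumrB.
  by apply: eq_bigr => q _; rewrite brack_cup0 mulrBl.
have [cM dM] := cup_dots_motzkin mb rb tr.
rewrite /= -base // -IH ?(ltnW tr) // -(pair_with_pvec p cM) -(pair_with_pvec p dM).
rewrite /pair_with big_distrr -!sumrB; apply: eq_bigr => q _.
by rewrite (brack_cupS mb) ?rb //= !mulrBl mulrA.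
Qed.

Lemma pair_with_bracket p q : p \in M -> q \in M -> last 0 q = -1 ->
  pair_with k r p (bracket q) =
  if cup_at r (strandPQ k p (pplus q)) (strandQQ k p (pplus q)) r
  then xK ^+ mid_loops k p (pplus q) * (uK r.+1 / uK r) else 0.
Proof.
move=> pM qM qK; have [mb rb wb eq ->] := pplusP qM qK.
have /motzkinP[mp _] := pM; have rp := motzkin_wrank pM.
rewrite pair_with_brack_cup // (bracket_valueE (strandQQC mp mb rb)
  (strandPQ_inj mp mb rp rb) (strandPQ_fun mp mb rp rb) (strandPQ_QQ mp mb rp rb)
  (strandQQ_fun mp mb rb) (strandPQ_planar mp mb rp rb) _ uK0 uK1 uKSS uK_neq0) //.
by rewrite ltnn /=; case: ifP => _ //; rewrite mulr0.
Qed.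

(** The surviving case needs an arc between the last two whites of q_+, one of which is the last
    vertex. Neither q_+ nor p has an edge there, so the vertex is isolated. *)
Lemma pair_with_bracket0 p q : p \in M -> q \in M -> last 0 p <> -1 -> last 0 q = -1 ->
  pair_with k r p (bracket q) = 0.
Proof.
move=> pM qM pK qK; rewrite pair_with_bracket //.
have [mb rb wb eq _] := pplusP qM qK; have /motzkinP[mp _] := pM.
have bK : (pplus q)`_m != -1.
  by have := white_wpos mb (_ : (r.+1 < wrank (pplus q) k)%N); rewrite rb wb => /(_ (ltnSn _)) /(white_step mb) ->.
case: ifP => // /andP[]; rewrite /strandQQ wb.
have [u [eu _ iu]] := @wpos_ord k (pplus q) r mb ltac:(by rewrite rb).
rewrite eu -[m]/(val (ord_max : 'I_k)) connect_posE (connect_symC (@mid_symmetric k p _)).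
rewrite connect_last //; last by apply/eqP; rewrite -(motzkin_last pM).
move=> /eqP e; have := wrank_wpos mb (_ : (r.+1 < wrank (pplus q) k)%N).
by rewrite wb rb => /(_ (ltnSn _)); move: iu; rewrite -e /= => ->; lia.
Qed.

(** Paired and unpaired opening vertices both have step 1, so p_+ differs from p only in the last
    entry. *)
Lemma pplus_rcons p : p \in M -> last 0 p = -1 -> pprime (pplus p) = pprime p /\ (pplus p)`_m = 1.
Proof.
move=> pM pK; have [mb rb wb ec _] := pplusP pM pK; have sz := mp_size mb.
move: mb rb wb ec sz; move: (pplus p) => b mb rb wb ec sz; split; last first.
  have := white_wpos mb (_ : (r.+1 < wrank b k)%N); rewrite rb wb => /(_ (ltnSn _)).
  by move/(white_step mb).
rewrite -ec wb /pprime /cup size_set_nth sz maxnn /=.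
apply: (@eq_from_nth _ 0) => [|n]; first by rewrite !size_take size_set_nth sz maxnn.
rewrite size_take sz ltnSn => nm; rewrite !nth_take // nth_set_nth /=.
by case: eqP => // e; rewrite e ltnn in nm.
Qed.

(** Compare p with p_+, which lacks the pivot edge from [l] to the last vertex. For p_+ and q_+ the
    last vertex is isolated, so the pivot edge closes no cycle. An arc of q_+ at [r] must use this
    edge, hence amounts to a strand from [l] to the white of rank [r] in q_+. The pairing becomes
    that of p_+ and q_+, both ending in 1, and their last step can be deleted. *)
Lemma pair_with_bracket_last p q : p \in M -> q \in M -> last 0 p = -1 -> last 0 q = -1 ->
  pair_with k r p (bracket q) =
  uK r.+1 / uK r * pairing m (pprime (pplus p)) (pprime (pplus q)).
Proof.
move=> pM qM pK qK; rewrite pair_with_bracket //.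
have [mb rb wb _ _] := pplusP qM qK; have [mc rc wc ec _] := pplusP pM pK.
have [_ bK] := pplus_rcons qM qK; have [_ cK] := pplus_rcons pM pK.
have /motzkinP[mp _] := pM; have rp := motzkin_wrank pM.
set b := pplus q in mb rb wb bK *; set c := pplus p in mc rc wc ec cK *.
have cb : psum c k = psum b k.
  by have := wrank_size mb; have := wrank_size mc; rewrite rb rc => <- <-.
have nK : 1 != -1 :> int by [].
rewrite -pairing_pprime ?cK ?bK // (pairingE mc mb cb).
have [l [el wl il]] := @wpos_ord k c r mc ltac:(by rewrite rc).
have [i [ei wi ii]] := @wpos_ord k b r mb ltac:(by rewrite rb).
have wm : white c (ord_max : 'I_k) by rewrite /= -wc; apply: (white_wpos mc); rewrite rc.
have im : wrank c (ord_max : 'I_k) = r.+1 by rewrite /= -[in LHS]wc; apply: (wrank_wpos mc); rewrite rc.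
have wbm : white b (ord_max : 'I_k) by rewrite /= -wb; apply: (white_wpos mb); rewrite rb.
have ibm : wrank b (ord_max : 'I_k) = r.+1 by rewrite /= -[in LHS]wb; apply: (wrank_wpos mb); rewrite rb.
have ac : wrank c (ord_max : 'I_k) = (wrank c l).+1 by rewrite il im.
have epc : p = cup c (ord_max : 'I_k) by rewrite /= -wc ec.
have conK y : connect (@mid k c b) ord_max y = (ord_max == y).
  by apply: connect_last => //; rewrite ?cK ?bK.
have symc := connect_symC (@mid_symmetric k c b).
have lmax : (l == ord_max) = false by apply/eqP => e; move: il; rewrite e im => /eqP; rewrite eqn_leq ltnn.
have imax : (i == ord_max) = false.
  by apply/eqP => e; move: ii; rewrite e ibm => /eqP; rewrite eqn_leq ltnn.
have -> : mid_loops k p b = mid_loops k c b.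
  rewrite mid_loopsC [in LHS]epc (mid_loops_cupr mc wl wm ac (mid_noncrossing mb mc)).
  rewrite (eq_connect (midC b c)) symc conK [ord_max == l]eq_sym lmax addn0.
  by rewrite mid_loopsC.
have con u v : connect (@mid k p b) u v =
    [|| connect (@mid k c b) u v, connect (@mid k c b) u l && (ord_max == v)
      | (u == ord_max) && connect (@mid k c b) l v].
  rewrite epc (eq_connect (mid_cupl b mc wl wm ac)) connect_add_edge conK.
  by rewrite [connect _ u ord_max]symc conK (eq_sym ord_max u).
have wposp s : (s < r)%N -> wpos p s = wpos c s.
  have tc : (r.+1 < wrank c k)%N by rewrite rc.
  move=> sr; rewrite (@wpos_skip k c p r mc mp tc) ?rp //.
    by congr wpos; rewrite /skip2 sr.
  by move=> x; rewrite {1}epc (white_cup mc wl wm ac) el wc.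
suff -> : cup_at r (strandPQ k p b) (strandQQ k p b) r = through k c b.
  by case: ifP => _; rewrite ?mulr0 // mulrC.
rewrite (through_wpos mc mb rc rb).
have strPQ a s : (a < r)%N -> (s < r)%N ->
   strandPQ k p b a (skip2 r s) = connect_pos (@mid k c b) (wpos c a) (wpos b s).
  move=> ar sr; have -> : skip2 r s = s by rewrite /skip2 sr.
  rewrite /strandPQ wposp //.
  have [u [-> wu iu]] := @wpos_ord k c a mc ltac:(by rewrite rc !leqW).
  have [v [-> wv iv]] := @wpos_ord k b s mb ltac:(by rewrite rb !leqW).
  have umax : (u == ord_max) = false.
    by apply/eqP => e; move: iu ar; rewrite e im => <-; rewrite ltnNge leqnSn.
  have vmax : (ord_max == v) = false.
    by apply/eqP => e; move: iv sr; rewrite -e ibm => <-; rewrite ltnNge leqnSn.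
  by rewrite !connect_posE con umax vmax andbF /= orbF.
have strQQ : strandQQ k p b r r.+1 = connect (@mid k c b) l i.
  rewrite /strandQQ ei wb -[m]/(val (ord_max : 'I_k)) connect_posE con.
  by rewrite symc conK eq_sym imax eqxx andbT /= orbF symc.
rewrite /cup_at strQQ; apply/andP/forallP => [[li dt] a|h].
  apply/forallP => s; apply/eqP.
  have [u [eu wu iu]] := @wpos_ord k c a mc ltac:(by rewrite rc).
  have [v [ev wv iv]] := @wpos_ord k b s mb ltac:(by rewrite rb).
  have dtP a' s' (a'r : (a' < r)%N) (s'r : (s' < r)%N) :
      connect_pos (@mid k c b) (wpos c a') (wpos b s') = (a' == s').
    by rewrite -strPQ //; have /dots_throughP -> := dt.
  rewrite eu ev connect_posE -val_eqE /=.
  have bmax (z : 'I_k) : white b z -> (ord_max == z) = (wrank b z == r.+1).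
    move=> wz; apply/eqP/eqP => [<-//|ez]; apply: val_inj.
    by apply: (wrank_inj wbm wz); rewrite ibm ez.
  have cmax (z : 'I_k) : white c z -> (z == ord_max) = (wrank c z == r.+1).
    move=> wz; apply/eqP/eqP => [->//|ez]; apply: val_inj.
    by apply: (wrank_inj wz wm); rewrite im ez.
  (* Rank [r.+1] belongs to the isolated last vertex, rank [r] to the strand from [l] to [i], and
     the smaller ranks are governed by [dots_through]. *)
  have [ea|na] := eqVneq (nat_of_ord a) r.+1.
    have -> : u = ord_max by apply/eqP; rewrite cmax // iu ea.
    by rewrite conK bmax // iv ea eq_sym.
  have [es|ns] := eqVneq (nat_of_ord s) r.+1.
    have -> : v = ord_max by apply/eqP; rewrite eq_sym bmax // iv es.
    by rewrite symc conK eq_sym cmax // iu es.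
  have ar := ltn_ord a; have sr := ltn_ord s.
  have [ea|na'] := eqVneq (nat_of_ord a) r; have [es|ns'] := eqVneq (nat_of_ord s) r.
  - have -> : u = l by apply: val_inj; rewrite /= -eu ea el.
    by have -> : v = i; [apply: val_inj; rewrite /= -ev es ei | rewrite li ea es eqxx].
  - have ul : u = l by apply: val_inj; rewrite /= -eu ea el.
    apply/idP/eqP => [lv|e]; last by case/eqP: ns'; rewrite -e ea.
    rewrite ul in lv; have e := @whites_uniq k c b mc mb (l, true) (v, false) (i, false) wl wv wi lv li.
    have [vi] : (v, false) = (i, false) by apply: e; rewrite xpair_eqE andbF.
    by case/eqP: ns'; rewrite -iv vi ii.
  - have vi : v = i by apply: val_inj; rewrite /= -ev es ei.
    apply/idP/eqP => [ui|e]; last by case/eqP: na'; rewrite e es.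
    rewrite vi symc in ui; have il' := li; rewrite symc in il'.
    have e := @whites_uniq k c b mc mb (i, false) (u, true) (l, true) wi wu wl ui il'.
    have [ul] : (u, true) = (l, true) by apply: e; rewrite xpair_eqE andbF.
    by case/eqP: na'; rewrite -iu ul il.
  have ltr (n : nat) : (n < r.+2)%N -> n != r.+1 -> n != r -> (n < r)%N.
    by move=> h1 h2 h3; clear -h1 h2 h3; lia.
  by rewrite -(connect_posE _ u v) -eu -ev dtP // ltr.
split.
  have := h (Ordinal (ltnW (ltnSn r.+1))).
  move/forallP/(_ (Ordinal (ltnW (ltnSn r.+1)))); rewrite /= el ei connect_posE eqxx.
  by move/eqP.
apply/dots_throughP => a s ar sr; rewrite strPQ //.
have /forallP := h (Ordinal (leqW (leqW ar))).
by move/(_ (Ordinal (leqW (leqW sr))))/eqP.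
Qed.

End Main.

(** * The basis *)

Section Basis.
Variables m r : nat.
Local Notation k := m.+1.
Local Notation M := (motzkin k r%:Z).

Lemma pvec_neq (p q : seq int) n : p`_n != q`_n -> pvec p q = 0.
Proof. by move=> pq; rewrite /pvec; case: eqP => // e; rewrite e eqxx in pq. Qed.

(** For [t < r] the cups and dots involved lie left of the last vertex, which keeps its step 1. *)
Lemma brack_cup_last b t q : motzkin_path k b -> wrank b k = r.+2 -> wpos b r.+1 = m ->
  b`_m = 1 -> (t < r)%N -> q`_m = -1 -> brack_cup b t q = 0.
Proof.
move=> mb rb wb bm; have ne s : (s < r.+1)%N -> (m == wpos b s) = false.
  move=> sr; apply/eqP => e.
  have s1 : wrank b (wpos b s) = s by apply: (wrank_wpos mb); rewrite rb ltnW.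
  have : wrank b (wpos b r.+1) = r.+1 by apply: (wrank_wpos mb); rewrite rb.
  by rewrite wb e s1 => se; rewrite se ltnn in sr.
elim: t => [|t IH] tr qm.
  rewrite (brack_cup0 b) !(@pvec_neq _ _ m) ?subrr // /pdot /cup !nth_set_nth /= ?nth_set_nth /=;
  by rewrite ?ne ?bm ?qm // ltnW.
rewrite (brack_cupS mb) ?rb; last by rewrite !ltnS ltnW.
rewrite IH ?(ltnW tr) // mulr0 subr0.
rewrite !(@pvec_neq _ _ m) ?subrr // /pdot /cup !nth_set_nth /= ?nth_set_nth /=;
by rewrite ?ne ?bm ?qm // ltnW.
Qed.

(** Triangularity: the top dots term ends in 0 and all lower terms end in 1, so p is the only term
    of [p] that ends in -1. *)
Lemma bracket_down p q : p \in M -> last 0 p = -1 -> q`_m = -1 -> bracket p q = (q == p)%:R.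
Proof.
move=> pM pm qm; have [mb rb wb ec ->] := pplusP pM pm; have [_ bm] := pplus_rcons pM pm.
have last_terms : pvec (cup (pplus p) (wpos (pplus p) r.+1)) q -
    pvec (pdot (pplus p) (wpos (pplus p) r) (wpos (pplus p) r.+1)) q = (q == p)%:R.
  rewrite ec (@pvec_neq (pdot _ _ _) _ m) ?subr0 //.
  by rewrite wb /pdot nth_set_nth /= eqxx qm.
have low t : (t < r)%N -> brack_cup (pplus p) t q = 0.
  by move=> tr; apply: brack_cup_last.
move: last_terms low mb rb; case: (r) => [|r'] last_terms low mb rb.
  by rewrite brack_cup0.
by rewrite (brack_cupS mb) ?rb // last_terms low // mulr0 subr0.
Qed.

(** All terms of [p] other than p end in 0 or 1 and are orthogonal to [w]. This reduces the pairing
    of two brackets to that of a path with a bracket. *)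
Lemma gform_bracket p w : p \in M -> last 0 p = -1 ->
  (forall q, q \in M -> last 0 q <> -1 -> pair_with k r q w = 0) ->
  gform k r (bracket p) w = pair_with k r p w.
Proof.
move=> pM pm w0; rewrite -(gform_pvec w pM) !gformE big_seq [RHS]big_seq.
apply: eq_bigr => q qM; have [qm|/eqP qm] := eqVneq (last 0 q) (-1).
  by rewrite bracket_down // -(motzkin_last qM).
by rewrite w0 ?mulr0.
Qed.

Lemma rowv_sum v : rowv k r v = \sum_(q <- M) v q *: rowv k r (pvec q).
Proof.
apply/rowP => t; rewrite summxE mxE.
have tM : nth [::] M t \in M by rewrite mem_nth.
rewrite -(sum_pvec v (motzkin_uniq k r) tM) big_mkcond; apply: eq_bigr => q _.
by rewrite !mxE /pvec eq_sym; case: eqP => _; rewrite ?mulr1 ?mulr0.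
Qed.

Lemma rowv_pvec_nth (t : 'I_(size M)) : rowv k r (pvec (nth [::] M t)) = delta_mx 0 t.
Proof.
by apply/rowP => s; rewrite !mxE /pvec eqxx nth_uniq ?motzkin_uniq.
Qed.

(** The family has as many members as the dimension, so spanning is enough. Up to paths not ending
    in -1, which belong to the family themselves, [p] equals p. *)
Lemma basis_tb : basis_of fullv [seq rowv k r (tb p) | p <- M].
Proof.
set X := [seq _ | p <- _].
have flat p : p \in M -> last 0 p != -1 -> rowv k r (pvec p) \in <<X>>%VS.
  move=> pM pm; have <- : tb p = pvec p by rewrite /tb (negPf pm).
  exact/memv_span/(map_f (fun p => rowv k r (tb p))).
have unit p : p \in M -> rowv k r (pvec p) \in <<X>>%VS.
  move=> pM; have [pm|pm] := eqVneq (last 0 p) (-1); last exact: flat.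
  have -> : rowv k r (pvec p) = rowv k r (tb p)
      - \sum_(q <- M | last 0 q != -1) tb p q *: rowv k r (pvec q).
    rewrite [rowv k r (tb p)]rowv_sum (bigID (fun q => last 0 q != -1)) /= addrAC subrr add0r.
    rewrite -[LHS](sum_pvec (fun q => rowv k r (pvec q)) (motzkin_uniq k r) pM).
    rewrite big_mkcond [RHS]big_mkcond big_seq [RHS]big_seq; apply: eq_bigr => q qM.
    have [qm|qm] /= := eqVneq (last 0 q) (-1); last by case: eqP => // qp; rewrite qp pm in qm.
    rewrite /tb pm /= bracket_down // -?(motzkin_last qM) //.
    by case: eqP => _; rewrite ?scale1r ?scale0r.
  apply: rpredB; first exact/memv_span/(map_f (fun p => rowv k r (tb p))).
  rewrite big_seq_cond; apply: rpred_sum => q /andP[qM qm].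
  by apply: rpredZ; apply: flat.
rewrite basisEdim size_map dimvf dim_matrix [X in (_ <= X)%N]mul1n leqnn andbT.
apply/subvP => w _; rewrite (row_sum_delta w); apply: rpred_sum => t _; apply: rpredZ.
by rewrite -rowv_pvec_nth; apply: unit; rewrite mem_nth.
Qed.

End Basis.

(** * The block form of the Gram matrix *)

Unset Implicit Arguments.

Theorem mainTheorem15 (k r : nat) : (2 <= k)%N -> (r <= k)%N ->
  (* the family (p, p, [p]) is a basis of C_k^(r) *)
  basis_of fullv [seq rowv k r%:Z (tb p) | p <- motzkin k r%:Z]
  (* the index bijections *)
  /\ perm_eq [seq pprime p | p <- motzkin k r%:Z & last 0 p == 1] (motzkin k.-1 (r%:Z - 1))
  /\ perm_eq [seq pprime p | p <- motzkin k r%:Z & last 0 p == 0] (motzkin k.-1 r%:Z)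
  /\ perm_eq [seq pprime (pplus p) | p <- motzkin k r%:Z & last 0 p == -1]
             (motzkin k.-1 (r%:Z + 1))
  (* diagonal blocks *)
  /\ {in motzkin k r%:Z &, forall p q, last 0 p = 1 -> last 0 q = 1 ->
        gform k r%:Z (tb p) (tb q) = pairing k.-1 (pprime p) (pprime q)}
  /\ {in motzkin k r%:Z &, forall p q, last 0 p = 0 -> last 0 q = 0 ->
        gform k r%:Z (tb p) (tb q) = pairing k.-1 (pprime p) (pprime q)}
  /\ {in motzkin k r%:Z &, forall p q, last 0 p = -1 -> last 0 q = -1 ->
        gform k r%:Z (tb p) (tb q)
        = uK r.+1 / uK r * pairing k.-1 (pprime (pplus p)) (pprime (pplus q))}
  (* off-diagonal blocks vanish *)
  /\ {in motzkin k r%:Z &, forall p q, last 0 p <> last 0 q ->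
        gform k r%:Z (tb p) (tb q) = 0}.
Proof.
case: k => // m _ _; rewrite [m.+1.-1]/=.
have tb_flat p : last 0 p != -1 -> tb p = pvec p by move=> pm; rewrite /tb (negPf pm).
have tb_down p : last 0 p = -1 -> tb p = bracket p by move=> pm; rewrite /tb pm.
have flatE p q : p \in motzkin m.+1 r -> q \in motzkin m.+1 r -> last 0 p != -1 ->
    last 0 p = last 0 q -> gform m.+1 r (tb p) (tb q) = pairing m (pprime p) (pprime q).
  move=> pM qM pm pq; rewrite !tb_flat -?pq // gform_pvec // pair_with_pvec //.
  have /motzkinP[mp pr] := pM; have /motzkinP[mq qr] := qM.
  move: pm pq; rewrite (motzkin_last pM) (motzkin_last qM) => pm pq.
  by apply: pairing_pprime; rewrite ?pr ?qr -?pq.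
have mixed p q : p \in motzkin m.+1 r -> q \in motzkin m.+1 r ->
    last 0 p <> -1 -> last 0 q = -1 -> gform m.+1 r (tb p) (tb q) = 0.
  move=> pM qM /eqP pm qm; rewrite tb_flat // tb_down // gform_pvec //.
  by apply: pair_with_bracket0 => //; apply/eqP.
(* The last vertex is white in p, black in q and isolated in the superposition, so it cannot be
   joined to the white of q of its rank. *)
have white_black p q : p \in motzkin m.+1 r -> q \in motzkin m.+1 r ->
    last 0 p = 1 -> last 0 q = 0 -> gform m.+1 r (tb p) (tb q) = 0.
  move=> pM qM pm qm; rewrite !tb_flat ?pm ?qm // gform_pvec // pair_with_pvec //.
  have /motzkinP[mp pr] := pM; have /motzkinP[mq qr] := qM.
  have rp := motzkin_wrank pM; have rq := motzkin_wrank qM.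
  rewrite (pairingE mp mq) ?pr ?qr //; case: throughP => // h.
  rewrite (motzkin_last pM) in pm; rewrite (motzkin_last qM) in qm.
  have wp : white p (ord_max : 'I_m.+1).
    apply/(whiteP mp); split=> // n /= nm; have -> : n = m.+1 by lia.
    by rewrite psumS pm ltrDl.
  have lt := wrank_ltn mp wp; rewrite rp -rq in lt.
  have [v [_ wv iv]] := wpos_ord mq lt.
  have := h _ _ wp wv; rewrite iv eqxx connect_last ?pm ?qm // => /eqP e.
  by have := white_step mq wv; rewrite -e /= qm.
split; first exact: basis_tb.
split; first exact: perm_pprime.
split; first by rewrite -[X in motzkin m X]subr0; apply: perm_pprime.
split.
  have -> : [seq pprime (pplus p) | p <- motzkin m.+1 r & last 0 p == -1]
      = [seq pprime p | p <- motzkin m.+1 r & last 0 p == -1].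
    apply/eq_in_map => p; rewrite mem_filter => /andP[/eqP pm pM].
    by have [] := pplus_rcons pM pm.
  by rewrite -[X in r%:Z + X]opprK; apply: perm_pprime.
split; first by move=> p q pM qM pm qm; apply: flatE => //; rewrite pm ?qm.
split; first by move=> p q pM qM pm qm; apply: flatE => //; rewrite pm ?qm.
split.
  move=> p q pM qM pm qm; rewrite (tb_down p) // (tb_down q) // gform_bracket //.
    exact: pair_with_bracket_last.
  by move=> p' p'M p'm; apply: pair_with_bracket0.
move=> p q pM qM; have [pm|pm|pm] := motzkin_last_cases pM;
  have [qm|qm|qm] := motzkin_last_cases qM; rewrite pm qm // => _.
- exact: white_black.
- by apply: mixed; rewrite ?pm.
- by rewrite gformC; apply: white_black.
- by apply: mixed; rewrite ?pm.
- by rewrite gformC; apply: mixed; rewrite ?qm.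
- by rewrite gformC; apply: mixed; rewrite ?qm.
Qed.
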